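(* Let $p(m,n)$ denote the number of (unordered) pairs of (non-oriented) prime segments in convex position with all endpoints in $\mathcal{G}_{m,n}=\{0,\dots,m-1\}\times\{0,\dots,n-1\}$. Then, as $\min(m,n)\to\infty$, $$p(m,n)=\frac{25}{12\pi^4}\,m^4n^4+o(m^4n^4).$$
   Context: A segment $AB$ with distinct integer endpoints $A,B\in\mathbb{Z}^2$ is prime if $A$ and $B$ are the only integer points on it. Two segments are in convex position if they are opposite sides of a (non-degenerate) convex quadrilateral. *)

(* Defs.v *)
From mathcomp Require Import all_boot all_order all_algebra.
From mathcomp Require Import boolp reals.

Set Implicit Arguments.
Unset Strict Implicit.
Unset Printing Implicit Defensive.

Import Order.TTheory GRing.Theory Num.Theory.
Local Open Scope ring_scope.

Definition int_point (R : realType) (A : int * int) : R * R :=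
  (A.1%:~R, A.2%:~R).

Definition on_segment (R : realType) (P Q Z : R * R) : Prop :=
  exists t : R, [/\ 0 <= t, t <= 1 &
    Z = ((1 - t) * P.1 + t * Q.1, (1 - t) * P.2 + t * Q.2)].

Definition prime_segment (R : realType) (A B : int * int) : Prop :=
  A <> B /\
  forall Z : int * int,
    on_segment (int_point R A) (int_point R B) (int_point R Z) ->
    Z = A \/ Z = B.

(* Twice the signed area of the triangle PQZ: its sign tells on which side of
   the line PQ the point Z lies. *)
Definition orient (R : realType) (P Q Z : R * R) : R :=
  (Q.1 - P.1) * (Z.2 - P.2) - (Q.2 - P.2) * (Z.1 - P.1).

Definition same_side (R : realType) (P Q Y Z : R * R) : bool :=
  0 < orient P Q Y * orient P Q Z.

(* P, Q, S, T are the vertices in cyclic order, so the sides are PQ, QS, ST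
   and TP; for each side, the other two vertices lie strictly on one side of
   its line.  Strictness excludes the degenerate quadrilaterals, with equal
   vertices or three collinear ones, and self-intersecting ones fail the
   condition as well. *)
Definition convex_quadrilateral (R : realType) (P Q S T : R * R) : bool :=
  [&& same_side P Q S T, same_side Q S T P, same_side S T P Q
    & same_side T P Q S].

Definition grid_point (m n : nat) (a : 'I_m * 'I_n) : int * int :=
  ((val a.1)%:Z, (val a.2)%:Z).

(* A non-oriented segment is represented by the set of its two endpoints. *)
Definition is_prime_segment (R : realType) (m n : nat)
    (s : {set 'I_m * 'I_n}) : Prop :=
  exists a b : 'I_m * 'I_n,
    s = [set a; b] /\ prime_segment R (grid_point a) (grid_point b).

(* The existential over a, b, c, d ranges over both ways of naming the
   endpoints of each segment, i.e. over the quadrilaterals abcd and abdc. *)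
Definition in_convex_position (R : realType) (m n : nat)
    (s t : {set 'I_m * 'I_n}) : Prop :=
  exists a b c d : 'I_m * 'I_n,
    [/\ s = [set a; b], t = [set c; d] &
        convex_quadrilateral
          (int_point R (grid_point a)) (int_point R (grid_point b))
          (int_point R (grid_point c)) (int_point R (grid_point d))].

Definition p (R : realType) (m n : nat) : nat :=
  #|[set st : {set {set 'I_m * 'I_n}} | `[< exists s t : {set 'I_m * 'I_n},
      [/\ st = [set s; t], is_prime_segment R s, is_prime_segment R t &
          in_convex_position R s t] >]]|.

(* Main.v *)
Require Import Defs.
From mathcomp Require Import all_boot all_order all_algebra.
From mathcomp Require Import all_classical all_reals all_analysis.
From mathcomp Require Import ring lra zify.
Import Order.TTheory GRing.Theory Num.Theory.
Import numFieldNormedType.Exports.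
Local Open Scope classical_set_scope.
Local Open Scope ring_scope.

(* Counted with labels, 2 p(m,n) is the sum of [abcd is convex, counterclockwise]
   times [ab prime] [cd prime].  For fixed a, c, d the convexity condition cuts
   out an interval in each coordinate of b, and residues are equidistributed on
   intervals, so a truncated Moebius sum replaces each primality indicator by
   its density 1 / zeta(2) = 6 / pi^2.  What remains is Sylvester's four-point
   problem for the grid: a quadruple in general position is convex unless one
   point lies in the triangle of the others, and the mean area of a triangle is
   11/144 of the square, so a quadruple is convex with probability
   1 - 4 (11/144) = 25/36; one cyclic order out of six gives 25/216.
   Hence p ~ (1/2) (25/216) (6/pi^2)^2 m^4 n^4. *)

(** * The value of zeta(2), from iterated halving of angles *)

(** No relation between m and n is assumed, so every geometric error is kept in the form constant
    times (mn)^3 (m+n), which is o(m^4 n^4) as soon as both sides grow. The Moebius sum must be cut: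
    each divisor costs a counting error m + n, and summing this over all divisors up to max(m,n)
    would not be small compared with mn. Cut at K, the head costs K (m+n) and the tail about mn/K; K
    depends only on the accuracy wanted and is fixed before m and n grow. The head needs a region
    that is an interval along each row and column. This is why labelled counterclockwise quadruples
    are counted: that condition is a conjunction of inequalities linear in b, whereas
    [convex_quadrilateral] asks for positive products. The 11/144 comes from sorting the three
    vertices by column. The middle vertex against the opposite side averages to 1/3 - x(1-x)/6 at
    relative position x, the mean over x is 11/36, and the squared width of the triangle supplies
    the rest. *)

Lemma sin_bounds (R : realType) (x : R) :
  0 < x < pi / 2 -> x * cos x <= sin x <= x.
Proof.
move=> /andP[x0 xpi].
have [c] := @MVT_segment R sin cos 0 x (ltW x0) (fun y _ => is_derive_sin y)
  (continuous_subspaceT (@continuous_sin R)).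
rewrite in_itv /= sin0 !subr0 => /andP[c0 cx] ->.
have pi0 := pi_gt0 R.
rewrite [x * _]mulrC ler_pM2r // leNgt ltr_cos ?in_itv /=; last 2 first.
- by apply/andP; split; lra.
- by apply/andP; split; lra.
by rewrite -leNgt cx ler_piMl ?cos_le1 ?ltW.
Qed.

(* Since sin x <= x <= tan x and 1 + cot^2 = 1 / sin^2. *)
Lemma inv_sin_sqr_bounds (R : realType) (x : R) : 0 < x < pi / 2 ->
  (x ^+ 2)^-1 <= (sin x ^+ 2)^-1 <= (x ^+ 2)^-1 + 1.
Proof.
move=> xpi; have /andP[h1 h2] := sin_bounds R x xpi.
have s0 := sin_gt0_pihalf xpi; have /andP[x0 _] := xpi.
have c0 : 0 < cos x.
  apply: cos_gt0_pihalf; case/andP: xpi => h ->.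
  by rewrite andbT (lt_trans _ h) // oppr_lt0 divr_gt0 ?pi_gt0.
apply/andP; split.
  rewrite lef_pV2 ?posrE ?exprn_gt0 //.
  by rewrite ler_sqr ?nnegrE // ltW.
have h : (x * cos x) ^+ 2 <= sin x ^+ 2.
  by rewrite ler_sqr ?nnegrE // ?mulr_ge0 // ltW.
have hc := cos2sin2 x.
have -> : (x ^+ 2)^-1 + 1 = (1 + x ^+ 2) / x ^+ 2 by field; rewrite gt_eqF.
rewrite -div1r ler_pdivrMr ?exprn_gt0 // mulrAC ler_pdivlMr ?exprn_gt0 //.
move: h; rewrite exprMn hc => h; lra.
Qed.

(** The second term is 1 / cos^2 x, and 1/sin^2 + 1/cos^2 = 1/(sin cos)^2. Writing the cosine as a
    sine of the reflected angle makes both terms members of the sum in [sum_inv_sin_sqr]. *)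
Lemma inv_sin_sqr_double (R : realType) (x : R) : 0 < x < pi / 2 ->
  (sin x ^+ 2)^-1 + (sin (pi / 2 - x) ^+ 2)^-1 = 4 * (sin (2 * x) ^+ 2)^-1.
Proof.
move=> xpi; have s0 := sin_gt0_pihalf xpi.
have c0 : 0 < cos x.
  apply: cos_gt0_pihalf; case/andP: xpi => h ->.
  by rewrite andbT (lt_trans _ h) // oppr_lt0 divr_gt0 ?pi_gt0.
rewrite sinB cos_pihalf sin_pihalf mul0r subr0 mul1r.
rewrite [2 * x]mulr_natl sin_mulr2n -mulr_natl.
have hc := cos2Dsin2 x.
transitivity ((cos x ^+ 2 + sin x ^+ 2) / (cos x ^+ 2 * sin x ^+ 2)).
  by field; rewrite !gt_eqF.
by rewrite hc; field; rewrite !gt_eqF.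
Qed.

Lemma sum_fold (V : nmodType) (f : nat -> V) (N : nat) :
  \sum_(i < N + N) f i = \sum_(i < N) (f i + f (N + N - i.+1)%N).
Proof.
rewrite big_split_ord /= big_split /=; congr (_ + _).
rewrite (reindex_inj rev_ord_inj) /=; apply: eq_bigr => i _.
by congr f; have := ltn_ord i; lia.
Qed.

(** The angles are the odd multiples of pi / 2^(n+2) below pi/2. Folding level n+1 pairs x with pi/2
    - x, and each pair equals 4 times the term of level n at 2x; level 0 is the single angle
    pi/4. *)
Lemma sum_inv_sin_sqr (R : realType) (n : nat) :
  \sum_(k < 2 ^ n) (sin ((2 * k + 1)%:R * pi / 2 ^+ (n + 2) : R) ^+ 2)^-1
  = 2 * 4 ^+ n.
Proof.
elim: n => [|n IH].
  rewrite expn0 big_ord1 /= expr0 mulr1.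
  have p0 := pi_gt0 R.
  have h : 0 < (pi / 4 : R) < (pi / 2 : R).
    by apply/andP; split; lra.
  have := inv_sin_sqr_double R (pi / 4) h.
  have -> : pi / 2 - pi / 4 = pi / 4 :> R by field.
  have -> : 2 * (pi / 4) = pi / 2 :> R by field.
  rewrite sin_pihalf expr1n invr1.
  have -> : (2 * 0 + 1)%:R * pi / 2 ^+ (0 + 2) = pi / 4 :> R.
    by rewrite /= -natrX mul1r.
  lra.
rewrite expnS mul2n -addnn.
rewrite (sum_fold _ (fun k => (sin ((2 * k + 1)%:R * pi / 2 ^+ (n.+1 + 2) : R) ^+ 2)^-1)).
rewrite exprS mulrCA -IH mulr_sumr; apply: eq_bigr => k _.
have e0 : (2 ^+ n : R) != 0 by rewrite expf_neq0.
have p0 := pi_gt0 R.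
have kn : (k < 2 ^ n)%N by [].
have kn1 : (k%:R + 1 <= 2 ^+ n :> R) by rewrite natr1 -natrX ler_nat.
have k0 : (0 <= k%:R :> R) by [].
have e1 : (0 < 2 ^+ n :> R) by rewrite exprn_gt0.
set x : R := (2 * k + 1)%:R * pi / 2 ^+ (n.+1 + 2).
have xE : x = (2 * k%:R + 1) / (8 * 2 ^+ n) * pi.
  by rewrite /x natrD natrM addSn addn2 !exprS; field.
(* The mirrored index of the fold is the reflected angle. *)
have -> : (2 * (2 ^ n + 2 ^ n - k.+1) + 1)%:R * pi / 2 ^+ (n.+1 + 2) = pi / 2 - x.
  rewrite xE natrD natrM natrB; last lia.
  by rewrite natrD natrX addSn addn2 !exprS -natr1; field.
have -> : (2 * k + 1)%:R * pi / 2 ^+ (n + 2) = 2 * x.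
  by rewrite xE natrD natrM addn2 !exprS; field.
apply: inv_sin_sqr_double; rewrite xE; apply/andP; split.
  by rewrite mulr_gt0 // divr_gt0 //; lra.
rewrite mulrC ltr_pM2l // ltr_pdivrMr; lra.
Qed.

Definition zeta2_sum (R : realType) (K : nat) : R :=
  \sum_(1 <= k < K.+1) (k%:R ^+ 2)^-1.

(** Summing [inv_sin_sqr_bounds] over the 2^n angles puts 16 * 4^n / pi^2 times the odd sum between
    2 * 4^n - 2^n and 2 * 4^n; the loss of 1 per angle becomes the error pi^2 / (16 * 2^n). *)
Lemma odd_zeta2_bounds (R : realType) (n : nat) :
  pi ^+ 2 / 8 - pi ^+ 2 / 16 / 2 ^+ n
  <= \sum_(k < 2 ^ n) ((2 * k + 1)%:R ^+ 2 : R)^-1 <= pi ^+ 2 / 8.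
Proof.
have p0 := pi_gt0 R.
have e0 : (2 ^+ n : R) != 0 by rewrite expf_neq0.
have e1 : (0 < 2 ^+ n :> R) by rewrite exprn_gt0.
have e4 : (4 ^+ n : R) = 2 ^+ n ^+ 2.
  by rewrite -exprM mulnC exprM; congr (_ ^+ _); rewrite -natrX.
set o := \sum_(k < _) _.
have P (k : 'I_(2 ^ n)) :
    let y := (2 * k + 1)%:R * pi / 2 ^+ (n + 2) : R in
    (y ^+ 2)^-1 <= (sin y ^+ 2)^-1 <= (y ^+ 2)^-1 + 1.
  apply: inv_sin_sqr_bounds.
  have kn1 : (k%:R + 1 <= 2 ^+ n :> R) by rewrite natr1 -natrX ler_nat.
  have k0 : (0 <= k%:R :> R) by [].
  have -> : (2 * k + 1)%:R * pi / 2 ^+ (n + 2) =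
      (2 * k%:R + 1) / (4 * 2 ^+ n) * pi :> R.
    by rewrite natrD natrM addn2 !exprS; field.
  apply/andP; split; first by rewrite mulr_gt0 // divr_gt0 //; lra.
  by rewrite mulrC ltr_pM2l // ltr_pdivrMr; lra.
have E : \sum_(k < 2 ^ n) (((2 * k + 1)%:R * pi / 2 ^+ (n + 2) : R) ^+ 2)^-1
    = o * (16 * 2 ^+ n ^+ 2 / pi ^+ 2).
  rewrite /o mulr_suml; apply: eq_bigr => k _.
  have k0 : (2 * k + 1)%:R != 0 :> R by rewrite pnatr_eq0 addn1.
  move: k0; move: (2 * k + 1)%:R => y y0.
  move: {P} p0; move: (@pi R) => q q0.
  by rewrite addn2 !exprS; field; rewrite e0 y0 gt_eqF.
have lo : o * (16 * 2 ^+ n ^+ 2 / pi ^+ 2) <= 2 * 2 ^+ n ^+ 2.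
  rewrite -E -e4 -sum_inv_sin_sqr; apply: ler_sum => k _.
  by case/andP: (P k).
have hi : 2 * 2 ^+ n ^+ 2 <= o * (16 * 2 ^+ n ^+ 2 / pi ^+ 2) + 2 ^+ n.
  have c1 : 2 ^+ n = \sum_(k < 2 ^ n) (1 : R).
    by rewrite sumr_const card_ord natrX.
  rewrite -E -e4 -sum_inv_sin_sqr [X in _ + X]c1 -big_split /=.
  by apply: ler_sum => k _; case/andP: (P k).
move: {P E} (@pi R) p0 lo hi => q q0; clearbody o => lo hi.
set t : R := 2 ^+ n in e0 e1 lo hi *.
have oE : o = o * (16 * t ^+ 2 / q ^+ 2) * (q ^+ 2 / 16 / t ^+ 2).
  by field; rewrite e0 gt_eqF.
have r0 : 0 < q ^+ 2 / 16 / t ^+ 2 by rewrite !divr_gt0 ?exprn_gt0.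
have tE : 2 * t ^+ 2 * (q ^+ 2 / 16 / t ^+ 2) = q ^+ 2 / 8 by field.
have sE : t * (q ^+ 2 / 16 / t ^+ 2) = q ^+ 2 / 16 / t by field.
have := ler_wpM2r (ltW r0) lo; have := ler_wpM2r (ltW r0) hi.
by rewrite tE [(_ + t) * _]mulrDl sE -oE => h1 h2; rewrite h2 lerBlDr h1.
Qed.

Lemma zeta2_sum_double (R : realType) (K : nat) :
  zeta2_sum R (2 * K) =
  \sum_(k < K) ((2 * k + 1)%:R ^+ 2)^-1 + zeta2_sum R K / 4.
Proof.
rewrite /zeta2_sum; elim: K => [|K IH].
  by rewrite muln0 !big_geq // big_ord0 mul0r addr0.
rewrite (_ : 2 * K.+1 = (2 * K).+2)%N; last lia.
rewrite !(big_nat_recr _.+1) //= IH big_ord_recr /=.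
rewrite mulrDl -!addrA; congr (_ + _).
rewrite addn1 addrC -!addrA; congr (_ + _); rewrite addrC; congr (_ + _).
rewrite (_ : (2 * K).+2 = 2 * K.+1)%N; last lia.
by rewrite natrM exprMn invfM mulrC; congr (_ * _); rewrite -natrX.
Qed.

(** Splitting off the odd terms gives the recursion z -> pi^2/8 + z/4, whose fixed point is pi^2/6.
    The error constants are such that a quarter of the old error plus the new one is at most half of
    the old error. *)
Lemma zeta2_sum_pow2 (R : realType) (n : nat) :
  pi ^+ 2 / 6 - pi ^+ 2 / 4 / 2 ^+ n <= zeta2_sum R (2 ^ n) <= pi ^+ 2 / 6 + 1 / 2 ^+ n.
Proof.
have p2 : (2 : R) <= pi := pi_ge2 R.
elim: n => [|n /andP[IH1 IH2]].
  rewrite /zeta2_sum expr0 expn0 big_nat1 expr1n invr1 mulr1.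
  by apply/andP; split; nra.
have /andP[p1 p3] := odd_zeta2_bounds R n.
rewrite expnS zeta2_sum_double.
rewrite (exprS 2 n) invfM !mul1r; rewrite mul1r in IH2.
set t := (2 ^+ n)^-1 in IH1 IH2 p1 *.
have t0 : 0 <= t by rewrite invr_ge0 exprn_ge0.
set P := pi ^+ 2 in IH1 IH2 p1 p3 *.
have P0 : 0 <= P * t by rewrite mulr_ge0 ?sqr_ge0.
apply/andP; split; lra.
Qed.

Lemma zeta2_sumS (R : realType) (K : nat) :
  zeta2_sum R K.+1 = zeta2_sum R K + (K.+1%:R ^+ 2)^-1.
Proof. by rewrite /zeta2_sum big_nat_recr. Qed.

(** The tail telescopes through 1/(x+1)^2 <= 1/x - 1/(x+1); keeping the subtracted last term makes
    the induction close. *)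
Lemma zeta2_sum_le_incr (R : realType) (K d : nat) :
  zeta2_sum R K <= zeta2_sum R (K + d) /\
  ((0 < K)%N -> zeta2_sum R (K + d) <= zeta2_sum R K + (K%:R)^-1 - ((K + d)%:R)^-1).
Proof.
elim: d => [|d [IH1 IH2]]; first by rewrite addn0; split=> // _; lra.
rewrite addnS zeta2_sumS.
split; first by apply: (le_trans IH1); rewrite lerDl invr_ge0 sqr_ge0.
move=> K0; have := IH2 K0.
have x0 : 0 < (K + d)%:R :> R by rewrite ltr0n addn_gt0 K0.
rewrite -(natr1 (K + d)); move: x0; set x := (K + d)%:R => x0.
suff : ((x + 1) ^+ 2)^-1 <= x^-1 - (x + 1)^-1 by lra.
have -> : x^-1 - (x + 1)^-1 = (x * (x + 1))^-1.
  by field; rewrite !gt_eqF //; lra.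
rewrite lef_pV2 ?posrE ?exprn_gt0 ?mulr_gt0 //; nra.
Qed.

(** The partial sums are estimated only at powers of two; this supplies one beyond a given K with
    error at most e. *)
Lemma exists_inv_pow2_le (R : realType) (c e : R) (K : nat) : 0 < c -> 0 < e ->
  exists2 n, (K <= 2 ^ n)%N & c / 2 ^+ n <= e.
Proof.
move=> c0 e0; pose n := (Num.bound (c / e) + K)%N; exists n.
  by rewrite ltnW // (leq_ltn_trans (leq_addl (Num.bound (c / e)) K)) // ltn_expl.
rewrite ler_pdivrMr ?exprn_gt0 // mulrC -ler_pdivrMr //.
have h : c / e < (Num.bound (c / e))%:R.
  by apply: archi_boundP; rewrite divr_ge0 ?ltW.
apply: (le_trans (ltW h)); rewrite -natrX ler_nat.
by rewrite ltnW // (leq_ltn_trans (leq_addr K _)) // ltn_expl.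
Qed.

Lemma zeta2_sum_le (R : realType) (K : nat) : zeta2_sum R K <= pi ^+ 2 / 6.
Proof.
apply/ler_addgt0Pr => e e0.
have [n Kn ne] := exists_inv_pow2_le R 1 e K ltr01 e0.
have [h1 _] := zeta2_sum_le_incr R K (2 ^ n - K).
rewrite subnKC // in h1; apply: (le_trans h1).
have /andP[_ h2] := zeta2_sum_pow2 R n; lra.
Qed.

Lemma zeta2_sum_ge (R : realType) (K : nat) : (0 < K)%N ->
  pi ^+ 2 / 6 <= zeta2_sum R K + (K%:R)^-1.
Proof.
move=> K0; apply/ler_addgt0Pr => e e0.
have c0 : 0 < pi ^+ 2 / 4 :> R by rewrite divr_gt0 ?exprn_gt0 ?pi_gt0.
have [n Kn ne] := exists_inv_pow2_le R _ e K c0 e0.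
have [_ /(_ K0) h2] := zeta2_sum_le_incr R K (2 ^ n - K).
rewrite subnKC // in h2.
have /andP[h1 _] := zeta2_sum_pow2 R n.
have : 0 <= ((2 ^ n)%:R : R)^-1 by rewrite invr_ge0.
lra.
Qed.

(** * Moebius sums *)

Definition mobius (R : realType) (n : nat) : R :=
  \prod_(p <- primes n) (if logn p n == 1%N then - 1 else 0).

Lemma mobius_norm (R : realType) (n : nat) : `|mobius R n| <= 1.
Proof.
rewrite /mobius; elim/big_rec: _ => [|p x _ xle1]; first by rewrite normr1.
by rewrite normrM mulr_ile1 //; case: ifP; rewrite ?normrN ?normr1 ?normr0.
Qed.

Lemma mobius1 (R : realType) : mobius R 1 = 1.
Proof. by rewrite /mobius big_nil. Qed.

(** If p divides e the product acquires a square, otherwise exactly one new prime. This is the sign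
    change behind the cancellation in [sum_mobius]. *)
Lemma mobius_mulp (R : realType) (p e : nat) : prime p -> (0 < e)%N ->
  mobius R (p * e) = if (p %| e)%N then 0 else - mobius R e.
Proof.
move=> pp e0; have p0 := prime_gt0 pp.
have pe0 : (0 < p * e)%N by rewrite muln_gt0 p0.
case: ifP => pe.
  rewrite /mobius (big_rem p) /=; last by rewrite mem_primes pp pe0 dvdn_mulr.
  rewrite lognM // logn_prime // eqxx -[1%N in X in _ == X]addn0 eqn_add2l.
  by rewrite -(negbK (_ == _)) -lt0n logn_gt0 mem_primes pp e0 pe mul0r.
have perm : perm_eq (primes (p * e)) (p :: primes e).
  apply: uniq_perm; rewrite /= ?primes_uniq // ?mem_primes ?pe ?andbF //.
  by move=> q; rewrite primesM // primes_prime // !inE.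
rewrite /mobius (perm_big _ perm) big_cons /=.
have -> : logn p (p * e) == 1%N.
  rewrite lognM // logn_prime // eqxx -[1%N in X in _ == X]addn0 eqn_add2l.
  by rewrite -(negbK (_ == _)) -lt0n logn_gt0 mem_primes pp e0 pe.
rewrite mulN1r; congr (- _); rewrite big_seq [RHS]big_seq.
apply: eq_bigr => q; rewrite mem_primes => /and3P[qp _ qe].
rewrite lognM // logn_prime //.
by case: (q =P p) => [qE|_] //; rewrite qE pe in qe.
Qed.

Lemma sum_multiples (V : nmodType) (g : nat -> V) (K d : nat) : (0 < d)%N ->
  \sum_(1 <= n < K.+1 | (d %| n)%N) g n
  = \sum_(1 <= k < (K %/ d).+1) g (d * k)%N.
Proof.
move=> d0; elim: K => [|K IH]; first by rewrite div0n !big_geq.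
rewrite big_mkcond big_nat_recr //= -big_mkcond IH divnS //.
case: ifP => dK; last by rewrite addr0.
rewrite add1n [RHS]big_nat_recr //=; congr (_ + g _).
have -> : (K %/ d).+1 = (K.+1 %/ d)%N by rewrite divnS // dK.
by rewrite mulnC divnK.
Qed.

(** For n > 1 take a prime p dividing n. The divisors d prime to p cancel against the divisors p *
    d, and the divisors with p^2 contribute 0. A common range up to K, rather than the divisors of
    n, allows later exchanges of sums. *)
Lemma sum_mobius (R : realType) (n K : nat) : (0 < n <= K)%N ->
  \sum_(1 <= d < K.+1 | (d %| n)%N) mobius R d = (n == 1%N)%:R.
Proof.
move=> /andP[]; case: eqP => [-> _ K0|/eqP n1 n0 nK].
  rewrite big_ltn_cond //= mobius1 big_nat_cond big_pred0 ?addr0 // => d.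
  by rewrite dvdn1; case: eqP => [->|]; rewrite ?andbF.
have pp : prime (pdiv n) by rewrite pdiv_prime // ltn_neqAle eq_sym n1.
set p := pdiv n in pp; have pn : (p %| n)%N by apply: pdiv_dvd.
have p0 := prime_gt0 pp.
rewrite (bigID (fun d => p %| d)%N) /= [X in X + _]big_mkcondl /=.
rewrite sum_multiples // -big_mkcond /=.
have -> : \sum_(1 <= e < (K %/ p).+1 | (p * e %| n)%N) mobius R (p * e) =
  - \sum_(1 <= e < (K %/ p).+1 | (p * e %| n)%N && ~~ (p %| e)%N) mobius R e.
  rewrite -sumrN [RHS]big_mkcondr /= big_seq_cond [RHS]big_seq_cond.
  apply: eq_bigr => e; rewrite mem_index_iota => /andP[/andP[e0 _] _].
  by rewrite mobius_mulp //; case: (p %| e)%N.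
apply/eqP; rewrite addrC subr_eq0; apply/eqP.
rewrite [RHS](big_nat_widen _ _ K.+1) ?ltnS ?leq_div //.
apply: eq_bigl => d; case: (boolP (p %| d)%N) => pd; rewrite ?andbF ?andbT //=.
have cpd : coprime p d by rewrite prime_coprime.
(* A divisor d prime to p lies in the shorter range up to K / p, since p * d still divides n. *)
rewrite Gauss_dvd // pn /=; case: (boolP (d %| n)%N) => //= dn.
rewrite ltnS leq_divRL // (leq_trans _ nK) // dvdn_leq // mulnC.
by rewrite Gauss_dvd ?pn.
Qed.

Definition mobius_sum (R : realType) (K : nat) : R :=
  \sum_(1 <= d < K.+1) mobius R d * ((d%:R)^-1) ^+ 2.

(** An exact finite form of zeta(2) * sum mu(d)/d^2 = 1: collecting the products d * k = n up to K
    leaves the sum of mu over the divisors of n, which vanishes unless n = 1. *)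
Lemma mobius_zeta2_sum (R : realType) (K : nat) : (0 < K)%N ->
  \sum_(1 <= d < K.+1) mobius R d * ((d%:R)^-1) ^+ 2 * zeta2_sum R (K %/ d) = 1.
Proof.
move=> K0.
transitivity (\sum_(1 <= d < K.+1) \sum_(1 <= n < K.+1)
   (if (d %| n)%N then mobius R d * (n%:R ^+ 2)^-1 else 0)).
  rewrite big_nat [RHS]big_nat; apply: eq_bigr => d /andP[d0 _].
  rewrite -big_mkcond (sum_multiples _ (fun n => mobius R d * (n%:R ^+ 2)^-1)) //.
  rewrite /zeta2_sum mulr_sumr; apply: eq_bigr => k _.
  by rewrite natrM exprMn [(_ * (k%:R ^+ 2))^-1]invfM exprVn mulrA.
rewrite exchange_big /= (eq_big_nat _ _ (F2 := fun n => (n == 1%N)%:R * (n%:R ^+ 2)^-1)).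
  rewrite big_ltn // eqxx expr1n invr1 mulr1 big_nat big1 ?addr0 // => n.
  by move=> /andP[n1 _]; rewrite gtn_eqF // mul0r.
move=> n nK; rewrite -big_mkcond -mulr_suml sum_mobius //.
Qed.

(** Terms up to L are at most 1, the others at most 1/L. For K = L^2 this is 2L, small enough
    compared with K, and it avoids logarithms. *)
Lemma harmonic_sum_le (R : realType) (K L : nat) : (0 < L)%N ->
  \sum_(1 <= d < K.+1) (d%:R : R)^-1 <= L%:R + K%:R / L%:R.
Proof.
move=> L0.
have sumL : \sum_(1 <= d < K.+1) ((d <= L)%N%:R : R) <= L%:R.
  elim: K => [|K IH]; first by rewrite big_geq.
  case: (leqP K.+1 L) => [KL|LK].
    have -> : \sum_(1 <= d < K.+2) ((d <= L)%N%:R : R) = \sum_(1 <= d < K.+2) 1.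
      apply: eq_big_nat => d /andP[_ dK].
      by rewrite (leq_trans _ KL).
    by rewrite big_const_nat iter_addr_0 subn1 /= ler_nat.
  by rewrite big_nat_recr //= leqNgt LK addr0.
apply: (@le_trans _ _ (\sum_(1 <= d < K.+1) ((d <= L)%N%:R + (L%:R)^-1))).
  apply: ler_sum_nat => d /andP[d0 _].
  case: (leqP d L) => dL.
    rewrite -[leLHS]addr0 lerD ?invr_ge0 // invf_le1 ?ltr0n //.
    by rewrite ler1n.
  by rewrite add0r lef_pV2 ?posrE ?ltr0n // ler_nat ltnW.
rewrite big_split /= lerD //.
by rewrite big_const_nat iter_addr_0 subn1 /= mulr_natl.
Qed.

(** Subtracting zeta(2) inside [mobius_zeta2_sum] leaves the terms mu(d)/d^2 times a tail of zeta(2)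
    beyond K / d, each at most 2/(K d). Their sum is at most (2/K)(L + K/L), which is 4/L when K =
    L^2. *)
Lemma mobius_sum_near (R : realType) (L : nat) : (0 < L)%N ->
  `|mobius_sum R (L ^ 2) - 6 / pi ^+ 2| <= 4 / L%:R.
Proof.
move=> L0; set K := (L ^ 2)%N; have K0 : (0 < K)%N by rewrite expn_gt0 L0.
(* This says 1 <= pi^2/6, so the final division by pi^2/6 does not enlarge the error. *)
have z1 := zeta2_sum_le R 1.
rewrite /zeta2_sum big_nat1 expr1n invr1 in z1.
have sE := mobius_zeta2_sum R K K0.
have lr0 : 0 < L%:R :> R by rewrite ltr0n.
have kr0 : 0 < K%:R :> R by rewrite ltr0n.
have zc : `|1 - pi ^+ 2 / 6 * mobius_sum R K| <= 4 / L%:R.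
  rewrite /mobius_sum mulr_sumr -[X in X - _]sE -sumrB.
  apply: (le_trans (ler_norm_sum _ _ _)).
  apply: (@le_trans _ _ (2 / K%:R * (L%:R + K%:R / L%:R))); last first.
    rewrite /K natrX le_eqVlt; apply/orP; left; apply/eqP; field.
    by rewrite gt_eqF.
  apply: (@le_trans _ _ (2 / K%:R * \sum_(1 <= d < K.+1) (d%:R : R)^-1)); last first.
    by rewrite ler_wpM2l ?divr_ge0 ?harmonic_sum_le.
  rewrite mulr_sumr; apply: ler_sum_nat => d /andP[d0 dK].
  rewrite [pi ^+ 2 / 6 * _]mulrC -mulrBr -[_ * _ * (_ - _)]mulrA normrM -[leRHS]mul1r.
  apply: ler_pM; rewrite ?normr_ge0 ?mobius_norm //.
  have dr0 : 0 < d%:R :> R by rewrite ltr0n.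
  set k := (K %/ d)%N; have k0 : (0 < k)%N by rewrite divn_gt0.
  have kz0 : 0 < k%:R :> R by rewrite ltr0n.
  have h1 := zeta2_sum_le R k; have h2 := zeta2_sum_ge R k k0.
  (* K < d (k + 1) and k >= 1, so rounding down loses at most a factor 2. *)
  have kK : K%:R <= 2 * (d%:R * k%:R) :> R.
    rewrite -!natrM ler_nat; have := ltn_ceil K d0; rewrite -/k.
    by nia.
  rewrite normrM [`|_ ^+ 2|]ger0_norm ?sqr_ge0 //.
  have : `|zeta2_sum R k - pi ^+ 2 / 6| <= k%:R^-1 by rewrite ler_norml; lra.
  move=> /(ler_wpM2l (sqr_ge0 (d%:R : R)^-1)) /le_trans; apply.
  have -> : (2 / K%:R) * (d%:R)^-1 = (2 * (d%:R * k%:R) / K%:R) * ((d%:R^-1)^+2 * k%:R^-1) :> R.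
    by field; rewrite !gt_eqF.
  rewrite -[leLHS]mul1r ler_wpM2r ?mulr_ge0 ?sqr_ge0 ?invr_ge0 //.
  by rewrite ler_pdivlMr // mul1r.
have p0 : 0 < pi ^+ 2 :> R by rewrite exprn_gt0 ?pi_gt0.
move: (@pi R ^+ 2) p0 z1 zc => q q0 z1 zc.
have -> : mobius_sum R K - 6 / q = - ((1 - q / 6 * mobius_sum R K) / (q / 6)).
  by field; rewrite gt_eqF.
rewrite normrN normrM; apply: le_trans zc; rewrite ler_piMr //.
by rewrite ger0_norm ?invr_ge0 ?invf_le1; lra.
Qed.

(** * Equidistribution on intervals and the sieve *)

Lemma natr_andb (R : pzSemiRingType) (a b : bool) : (a && b)%:R = a%:R * b%:R :> R.
Proof. by case: a b => [] []; rewrite ?mulr0 ?mulr1 ?mul0r. Qed.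

Lemma natr_bool_norm (R : numDomainType) (b : bool) : `|b%:R : R| <= 1.
Proof. by case: b; rewrite ?normr1 ?normr0. Qed.

Lemma norm_sum_le (R : numDomainType) (I : finType) (F : I -> R) (C : R) :
  (forall i, `|F i| <= C) -> `|\sum_i F i| <= #|I|%:R * C.
Proof.
move=> FC; apply: (le_trans (ler_norm_sum _ _ _)).
rewrite mulr_natl -sumr_const; exact: ler_sum.
Qed.

Lemma dvdn_distnE (k x i : nat) : (k %| `|i - x|)%N = (i == x %[mod k]).
Proof.
case: (leqP x i) => [h|/ltnW h]; first by rewrite distnEl // -eqn_mod_dvd.
by rewrite distnEr // eq_sym eqn_mod_dvd.
Qed.

(** Here N + s is the first number from N on that is congruent to x modulo k. It starts at x %% k
    and jumps by k at each hit, which makes the count exact. *)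
Lemma count_residue (k x N : nat) : (0 < k)%N ->
  exists2 s, (s < k)%N &
    (k * (\sum_(0 <= i < N) (k %| `|i - x|)) + x %% k = N + s)%N.
Proof.
move=> k0; elim: N => [|N [s sk IH]].
  by exists (x %% k)%N; rewrite ?ltn_mod // big_geq // muln0.
rewrite big_nat_recr //= mulnDr dvdn_distnE.
have E : (N + s = x %[mod k])%N by rewrite -IH mulnC modnMDl modn_mod.
case: eqP => [Nx|Nx].
  have s0 : s = 0%N.
    move: E => /eqP; rewrite -Nx -[X in _ == (X %% _)%N]addn0 eqn_modDl.
    by rewrite mod0n modn_small // => /eqP.
  by exists k.-1; rewrite s0 in IH; lia.
have s0 : (0 < s)%N by rewrite lt0n; apply/eqP => s0; rewrite s0 addn0 in E.
by exists s.-1; lia.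
Qed.

(** By [count_residue] at both ends the discrepancy is (t - s)/k with s, t < k, hence bounded
    independently of the length. *)
Lemma interval_residue (R : realType) (k x lo hi : nat) : (0 < k)%N -> (lo <= hi)%N ->
  `|\sum_(lo <= i < hi) ((k %| `|i - x|)%N%:R - (k%:R : R)^-1)| <= 1.
Proof.
move=> k0 lohi.
have k1 : 0 < k%:R :> R by rewrite ltr0n.
have [s sk Es] := count_residue k x lo k0; have [t tk Et] := count_residue k x hi k0.
rewrite (big_cat_nat _ lohi) //= in Et.
rewrite sumrB big_const_nat iter_addr_0 -natr_sum.
move: Es Et; set u := (\sum_(0 <= i < lo) _)%N; set v := (\sum_(lo <= i < hi) _)%N.
move=> Es Et.
have Ev : (k * v + lo + s = hi + t)%N by lia.
have -> : v%:R - (k%:R : R)^-1 *+ (hi - lo) = (t%:R - s%:R) / k%:R.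
  rewrite -[(k%:R)^-1 *+ _]mulr_natl natrB //.
  have -> : t%:R = (k%:R * v%:R + lo%:R + s%:R) - hi%:R :> R.
    by rewrite -natrM -!natrD Ev natrD; ring.
  by field; rewrite gt_eqF.
rewrite normrM normfV (gtr0_norm k1) ler_pdivrMr // mul1r ler_norml.
have : t%:R <= k%:R :> R by rewrite ler_nat ltnW.
have : s%:R <= k%:R :> R by rewrite ler_nat ltnW.
have : 0 <= t%:R :> R by []. have : 0 <= s%:R :> R by []. lra.
Qed.

(** Order-convexity stands in for explicit intervals: it is stable under conjunction and holds for
    linear inequalities, so no endpoint is ever computed. *)
Definition convex_pred (f : nat -> bool) :=
  forall i j k, (i <= j <= k)%N -> f i -> f k -> f j.

Lemma convex_pred_interval (f : nat -> bool) (N : nat) : convex_pred f ->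
  exists lo hi, (lo <= hi <= N)%N /\ forall i, (i < N)%N -> f i = (lo <= i < hi)%N.
Proof.
move=> cf; elim: N => [|N [lo [hi [/andP[lohi hiN] IH]]]]; first by exists 0, 0.
case fN : (f N); last first.
  exists lo, hi; rewrite lohi leqW //; split=> // i; rewrite ltnS leq_eqVlt.
  case/predU1P => [->|/IH//]; rewrite fN; apply/esym/negbTE; lia.
(* If nothing was true below N, the interval restarts at N; otherwise convexity forces the old one
   to end exactly at N. *)
move: lohi; rewrite leq_eqVlt => /predU1P[lohi|lohi].
  exists N, N.+1; rewrite leqnSn leqnn; split=> // i; rewrite ltnS leq_eqVlt.
  case/predU1P => [->|iN]; first by rewrite fN; lia.
  by rewrite IH // lohi; lia.
have flo : f lo by rewrite IH ?leqnn //; lia.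
have hN : hi = N.
  apply/eqP; rewrite eqn_leq hiN leqNgt; apply/negP => hN.
  have : f hi by apply: (cf lo hi N) => //; lia.
  by rewrite IH // ltnn andbF.
exists lo, N.+1; split; first lia.
move=> i iN; have -> : f i = (lo <= i)%N; last by rewrite iN andbT.
move: iN; rewrite ltnS leq_eqVlt => /predU1P[->|iN]; first by rewrite fN; lia.
by rewrite IH // hN iN andbT.
Qed.

Lemma convex_residue (R : realType) (f : nat -> bool) (N k x : nat) :
  convex_pred f -> (0 < k)%N ->
  `|\sum_(i < N) (f i)%:R * ((k %| `|i - x|)%N%:R - (k%:R : R)^-1)| <= 1.
Proof.
move=> cf k0; have [lo [hi [/andP[lohi hiN] fE]]] := convex_pred_interval f N cf.
pose h i : R := (k %| `|i - x|)%N%:R - (k%:R : R)^-1.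
have loN := leq_trans lohi hiN.
rewrite -(big_mkord xpredT (fun i => (f i)%:R * h i)) (big_cat_nat _ loN) //=.
rewrite [X in X + _]big_nat [X in X + _]big1 => [|i /andP[_ ilo]]; last first.
  by rewrite fE ?(leq_trans ilo) // leqNgt ilo mul0r.
rewrite add0r (big_cat_nat _ hiN) //= [X in _ + X]big_nat [X in _ + X]big1 => [|i /andP[hii iN]].
  rewrite addr0 (eq_big_nat _ _ (F2 := h)) ?interval_residue // => i /andP[loi ihi].
  by rewrite fE ?loi ?ihi ?mul1r // (leq_trans ihi).
by rewrite fE // [(i < hi)%N]ltnNge hii andbF mul0r.
Qed.

Definition biconvex_pred (f : nat -> nat -> bool) :=
  (forall j, convex_pred (f^~ j)) /\ (forall i, convex_pred (f i)).

(** The value is 0 when b is the point (x, y): every k then divides it, yet it is not 1. *)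
Definition point_gcd (x y : nat) (m n : nat) (b : 'I_m * 'I_n) : nat :=
  gcdn `|b.1 - x| `|b.2 - y|.

Lemma sum_pointE (V : nmodType) (m n : nat) (F : 'I_m -> 'I_n -> V) :
  \sum_(b : 'I_m * 'I_n) F b.1 b.2 = \sum_(i < m) \sum_(j < n) F i j.
Proof. by rewrite pair_big. Qed.

(** With u, v the divisibility indicators of the two coordinates and q = 1/k, u v - q^2 = v (u - q)
    + q (v - q). The first part is at most 1 on each of the n rows, the second at most 1 on each of
    the m columns. *)
Lemma biconvex_residue (R : realType) (f : nat -> nat -> bool) (m n k x y : nat) :
  biconvex_pred f -> (0 < k)%N ->
  `|\sum_(b : 'I_m * 'I_n) (f b.1 b.2)%:R *
     ((k %| point_gcd x y m n b)%N%:R - (k%:R : R)^-1 ^+ 2)| <= m%:R + n%:R.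
Proof.
move=> [cf1 cf2] k0; set q := (k%:R)^-1.
have q1 : `|q| <= 1 by rewrite ger0_norm ?invr_ge0 // invf_le1 ?ltr0n // ler1n.
pose u (i : nat) : R := (k %| `|i - x|)%N%:R; pose v (j : nat) : R := (k %| `|j - y|)%N%:R.
have -> : \sum_(b : 'I_m * 'I_n) (f b.1 b.2)%:R *
     ((k %| point_gcd x y m n b)%N%:R - q ^+ 2) =
   \sum_(j < n) v j * \sum_(i < m) (f i j)%:R * (u i - q)
   + \sum_(i < m) q * \sum_(j < n) (f i j)%:R * (v j - q).
  under [X in X + _]eq_bigr do rewrite mulr_sumr.
  under [X in _ + X]eq_bigr do rewrite mulr_sumr.
  rewrite [X in X + _]exchange_big /= -big_split /=.
  rewrite (sum_pointE _ _ _ (fun i j => (f i j)%:R *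
     ((k %| gcdn `|i - x| `|j - y|)%N%:R - q ^+ 2))).
  apply: eq_bigr => i _; rewrite -big_split; apply: eq_bigr => j _ /=.
  by rewrite dvdn_gcd natr_andb -/(u i) -/(v j); ring.
apply: (le_trans (ler_normD _ _)); rewrite addrC; apply: lerD.
  rewrite -[m%:R]mulr1 -[X in X%:R * 1]card_ord; apply: norm_sum_le => i.
  by rewrite normrM mulr_ile1 //; exact: convex_residue.
rewrite -[n%:R]mulr1 -[X in X%:R * 1]card_ord; apply: norm_sum_le => j.
rewrite normrM mulr_ile1 ?natr_bool_norm //.
exact: (convex_residue _ (f^~ j)).
Qed.

(** Leaving out x itself removes the additive 1 of a residue count. This matters for large k, where
    the sieve needs a bound of order 1/k. *)
Lemma count_residue_neq (R : realType) (N k : nat) (x : 'I_N) : (0 < k)%N ->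
  \sum_(i < N) ((i != x) && (k %| `|i - x|))%N%:R <= N%:R / k%:R :> R.
Proof.
move=> k0; have k1 : 0 < k%:R :> R by rewrite ltr0n.
have [s sk] := count_residue k x N k0.
rewrite big_mkord (bigD1 x) //= distnn dvdn0 => E.
rewrite -natr_sum (bigD1 x) //= eqxx add0n.
rewrite ler_pdivlMr // -natrM ler_nat.
have -> : (\sum_(i < N | i != x) ((i != x) && (k %| `|i - x|)) =
           \sum_(i < N | i != x) (k %| `|i - x|))%N.
  by apply: eq_bigr => i ->.
move: E; set S := (\sum_(i < N | _) _)%N; rewrite mulnDr muln1 => E; lia.
Qed.

Definition mobius_gcd_sum (R : realType) (K g : nat) : R :=
  \sum_(1 <= k < K.+1 | (k %| g)%N) mobius R k.

Lemma mobius_gcd_sum_error (R : realType) (K M g : nat) : (0 < g <= K + M)%N ->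
  `|(g == 1%N)%:R - mobius_gcd_sum R K g| <= \sum_(K.+1 <= k < (K + M).+1) (k %| g)%N%:R.
Proof.
move=> gM; rewrite -(sum_mobius R _ _ gM) /mobius_gcd_sum.
rewrite (@big_cat_nat _ _ _ K.+1) //=; last by rewrite ltnS leq_addr.
rewrite addrC addrK [X in `|X|]big_mkcond /=.
apply: (le_trans (ler_norm_sum _ _ _)); apply: ler_sum => k _.
by case: ifP; rewrite ?normr0 ?mobius_norm.
Qed.

Lemma mobius_gcd_sum_norm (R : realType) (K g : nat) : `|mobius_gcd_sum R K g| <= K%:R.
Proof.
rewrite /mobius_gcd_sum big_mkcond; apply: (le_trans (ler_norm_sum _ _ _)).
apply: (@le_trans _ _ (\sum_(1 <= k < K.+1) 1)).
  by apply: ler_sum => k _; case: ifP; rewrite ?normr0 ?mobius_norm.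
by rewrite big_const_nat iter_addr_0 subn1.
Qed.

(** On the row and the column of a the summand is bounded by 1 + K. Elsewhere it is at most the
    number of divisors k > K of the gcd; each k accounts for at most (m/k)(n/k) points, and the sum
    of 1/k^2 beyond K is at most 1/K. *)
Lemma sieve_tail (R : realType) (m n K : nat) (a : 'I_m * 'I_n) : (0 < K)%N ->
  \sum_(b : 'I_m * 'I_n)
     `|(point_gcd a.1 a.2 m n b == 1%N)%:R - mobius_gcd_sum R K (point_gcd a.1 a.2 m n b)|
  <= (1 + K%:R) * (m%:R + n%:R) + m%:R * n%:R / K%:R.
Proof.
move=> K0; pose M := (m + n)%N.
pose u k (i : 'I_m) : R := ((i != a.1) && (k %| `|i - a.1|))%N%:R.
pose v k (j : 'I_n) : R := ((j != a.2) && (k %| `|j - a.2|))%N%:R.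
pose w (i : 'I_m) (j : 'I_n) : R := (1 + K%:R) * ((i == a.1)%:R + (j == a.2)%:R)
   + \sum_(K.+1 <= k < (K + M).+1) u k i * v k j.
apply: (@le_trans _ _ (\sum_(b : 'I_m * 'I_n) w b.1 b.2)).
  apply: ler_sum => -[i j] _; rewrite /point_gcd /w /=.
  set g := gcdn _ _.
  have w0 : 0 <= \sum_(K.+1 <= k < (K + M).+1) u k i * v k j.
    by apply: sumr_ge0 => k _; rewrite mulr_ge0.
  have [ij|/norP[ia ja]] := boolP ((i == a.1) || (j == a.2)).
    rewrite -[leLHS]addr0; apply: lerD => //.
    apply: (@le_trans _ _ (1 + K%:R)).
      apply: (le_trans (ler_normB _ _)).
      by rewrite lerD ?natr_bool_norm ?mobius_gcd_sum_norm.
    rewrite ler_peMr ?addr_ge0 // -natrD ler1n.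
    by move: ij; case: (i == a.1); case: (j == a.2).
  have gE : g = gcdn `|i - a.1| `|j - a.2| by [].
  have di : (0 < `|i - a.1| < m)%N.
    by have := ltn_ord i; have := ltn_ord a.1; move: ia; rewrite -val_eqE /=; lia.
  (* Off the column of a the gcd is positive and below m, so the range up to K + M contains all its
     divisors. *)
  have gM : (0 < g <= K + M)%N.
    have g1 : (g <= `|i - a.1|)%N by rewrite dvdn_leq ?dvdn_gcdl; case/andP: di.
    by rewrite gcdn_gt0 /M; case/andP: di => -> ?; lia.
  rewrite (negbTE ia) (negbTE ja) addr0 mulr0 add0r.
  apply: (le_trans (mobius_gcd_sum_error R K M g gM)).
  apply: ler_sum => k _; rewrite /u /v ia ja /= -natrM mulnb -dvdn_gcd //.
rewrite (sum_pointE _ _ _ w) /w.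
under eq_bigr do rewrite big_split /=.
rewrite big_split /=; apply: lerD.
  under eq_bigr do rewrite -mulr_sumr.
  rewrite -mulr_sumr ler_wpM2l ?addr_ge0 //.
  under eq_bigr do rewrite big_split /=.
  rewrite big_split /= addrC; apply: lerD; last first.
    rewrite exchange_big /= -[leRHS]mulr1 mulr_natl -[X in _ *+ X]card_ord -sumr_const.
    apply: ler_sum => j _; rewrite (bigD1 a.1) //= eqxx big1 ?addr0 // => i.
    by move/negbTE ->.
  rewrite -[leRHS]mulr1 mulr_natl -[X in _ *+ X]card_ord -sumr_const.
  apply: ler_sum => i _; rewrite (bigD1 a.2) //= eqxx big1 ?addr0 // => j.
  by move/negbTE ->.
under eq_bigr do rewrite exchange_big /=.
rewrite exchange_big /=.
apply: (@le_trans _ _ (\sum_(K.+1 <= k < (K + M).+1) m%:R * n%:R * (k%:R ^+ 2)^-1)).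
  apply: ler_sum_nat => k /andP[k0 _].
  under eq_bigr do rewrite -mulr_sumr.
  rewrite -mulr_suml expr2 invfM mulrACA; apply: ler_pM; try exact: sumr_ge0.
    by apply: count_residue_neq; apply: leq_ltn_trans k0.
  by apply: count_residue_neq; apply: leq_ltn_trans k0.
rewrite -mulr_sumr ler_wpM2l ?mulr_ge0 //.
have [_ /(_ K0)] := zeta2_sum_le_incr R K M.
rewrite {1}/zeta2_sum (@big_cat_nat _ _ _ K.+1) //=; last by rewrite ltnS leq_addr.
rewrite -/(zeta2_sum R K).
have : 0 <= ((K + M)%:R : R)^-1 by rewrite invr_ge0.
lra.
Qed.

(** The indicator is replaced by its truncated Moebius sum, that sum by its mean density
    [mobius_sum R K], and the density by c. The middle replacement is where biconvexity is used. *)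
Lemma sieve (R : realType) (m n K : nat) (a : 'I_m * 'I_n) (f : nat -> nat -> bool) (c : R) :
  (0 < K)%N -> biconvex_pred f ->
  `|\sum_(b : 'I_m * 'I_n)
     (f b.1 b.2)%:R * ((point_gcd a.1 a.2 m n b == 1%N)%:R - c)|
  <= (1 + 2 * K%:R) * (m%:R + n%:R)
     + m%:R * n%:R * ((K%:R)^-1 + `|mobius_sum R K - c|).
Proof.
move=> K0 cf; pose g b := point_gcd a.1 a.2 m n b.
pose F (b : 'I_m * 'I_n) : R := (f b.1 b.2)%:R.
have -> : \sum_b F b * ((g b == 1%N)%:R - c) =
  \sum_b F b * ((g b == 1%N)%:R - mobius_gcd_sum R K (g b))
  + \sum_b F b * (mobius_gcd_sum R K (g b) - mobius_sum R K)
  + \sum_b F b * (mobius_sum R K - c).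
  by rewrite -!big_split; apply: eq_bigr => b _ /=; ring.
have h1 : `|\sum_b F b * ((g b == 1%N)%:R - mobius_gcd_sum R K (g b))|
    <= (1 + K%:R) * (m%:R + n%:R) + m%:R * n%:R / K%:R.
  apply: le_trans (sieve_tail R m n K a K0).
  apply: (le_trans (ler_norm_sum _ _ _)); apply: ler_sum => b _.
  by rewrite normrM ler_piMl ?natr_bool_norm.
have h2 : `|\sum_b F b * (mobius_gcd_sum R K (g b) - mobius_sum R K)|
    <= K%:R * (m%:R + n%:R).
  have -> : \sum_b F b * (mobius_gcd_sum R K (g b) - mobius_sum R K) =
     \sum_(1 <= k < K.+1) mobius R k *
       \sum_b F b * ((k %| g b)%N%:R - (k%:R)^-1 ^+ 2).
    under [RHS]eq_bigr do rewrite mulr_sumr.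
    rewrite [RHS]exchange_big; apply: eq_bigr => b _ /=.
    rewrite /mobius_gcd_sum /mobius_sum [X in X - _]big_mkcond -sumrB mulr_sumr.
    apply: eq_bigr => k _; case: (k %| g b)%N => /=; ring.
  apply: (le_trans (ler_norm_sum _ _ _)).
  apply: (@le_trans _ _ (\sum_(1 <= k < K.+1) (m%:R + n%:R))).
    apply: ler_sum_nat => k /andP[k0 _]; rewrite normrM -[leRHS]mul1r.
    apply: ler_pM; rewrite ?mobius_norm //; exact: biconvex_residue.
  by rewrite big_const_nat iter_addr_0 subn1 /= mulr_natl.
have h3 : `|\sum_b F b * (mobius_sum R K - c)| <= m%:R * n%:R * `|mobius_sum R K - c|.
  rewrite -natrM -[X in (X * _)%:R]card_ord -[X in (_ * X)%:R](card_ord n) -card_prod.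
  by apply: norm_sum_le => b; rewrite normrM ler_piMl ?natr_bool_norm.
apply: (le_trans (ler_normD _ _)); apply: (le_trans (lerD (ler_normD _ _) (lexx _))).
rewrite mulrDr; lra.
Qed.

(** * Counterclockwise quadrilaterals and prime segments *)

(** All four triples of vertices, in the order listed, turn left. For fixed P, S, T each conjunct is
    affine in Q. *)
Definition ccw {R : realType} (P Q S T : R * R) : bool :=
  [&& 0 < orient P Q S, 0 < orient P Q T, 0 < orient Q S T & 0 < orient P S T].

Lemma orient_rot (R : realType) (P Q S : R * R) : orient Q S P = orient P Q S.
Proof. rewrite /orient; ring. Qed.

Lemma orient_swap (R : realType) (P Q S : R * R) : orient Q P S = - orient P Q S.
Proof. rewrite /orient; ring. Qed.

Lemma orient_flip (R : realType) (P Q S : R * R) : orient P S Q = - orient P Q S.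
Proof. rewrite /orient; ring. Qed.

Lemma orient_rev (R : realType) (P Q S : R * R) : orient S Q P = - orient P Q S.
Proof. rewrite /orient; ring. Qed.

(** This exchanges the two opposite sides PQ and ST. *)
Lemma ccw_rot2 (R : realType) (P Q S T : R * R) : ccw S T P Q = ccw P Q S T.
Proof.
rewrite /ccw (orient_rot R P S T) (orient_rot R Q S T).
rewrite (orient_rot R T P Q) (orient_rot R S P Q).
by case: (0 < orient P S T); case: (0 < orient Q S T);
  case: (0 < orient T P Q); case: (0 < orient S P Q).
Qed.

(** The four positive products link the four orientations, so all have one sign. If it is negative,
    reading the vertices backwards gives a counterclockwise quadrilateral with the same pair of
    sides. *)
Lemma convex_quadrilateralE (R : realType) (P Q S T : R * R) :
  convex_quadrilateral P Q S T = ccw P Q S T || ccw T S Q P.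
Proof.
rewrite /convex_quadrilateral /ccw /same_side.
rewrite (orient_rot R P Q S) (orient_rot R P S T) (orient_rot R Q S T).
rewrite -(orient_rot R T P Q) -(orient_rot R T P S).
rewrite (orient_rev R Q S T) (orient_rev R P S T) (orient_rev R P Q T) (orient_rev R P Q S).
rewrite !oppr_gt0.
move: (orient P Q S) (orient P Q T) (orient Q S T) (orient P S T) => A B C D.
apply/and4P/orP => [[h1 h2 h3 h4]|].
  case: (ltrgtP A 0) h1 h2 h3 => [A0|A0|->]; last by rewrite mul0r ltxx.
    rewrite nmulr_rgt0 // nmulr_lgt0 // => B0 C0; rewrite nmulr_lgt0 // => D0.
    by right; apply/and4P.
  rewrite pmulr_rgt0 // pmulr_lgt0 // => B0 C0; rewrite pmulr_lgt0 // => D0.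
  by left; apply/and4P.
case=> /and4P[h1 h2 h3 h4]; first by rewrite !mulr_gt0.
by rewrite !nmulr_rgt0.
Qed.

Lemma ccw_neq (R : realType) (P Q S T : R * R) : ccw P Q S T ->
  [/\ P != Q, S != T & P != S].
Proof.
by case/and4P => h1 h2 h3 h4; split; apply/eqP => E; subst;
  move: h1 h3; rewrite /orient; lra.
Qed.

Lemma affine_convex (R : realType) (a b : R) :
  convex_pred (fun i => 0 < a * i%:R + b).
Proof.
move=> i j k /andP[ij jk] hi hk.
have {}ij : i%:R <= j%:R :> R by rewrite ler_nat.
have {}jk : j%:R <= k%:R :> R by rewrite ler_nat.
case: (lerP 0 a) => a0; first by have := ler_wpM2l a0 ij; lra.
by have := ler_wnM2l (ltW a0) jk; lra.
Qed.

Lemma convex_predI (f g : nat -> bool) : convex_pred f -> convex_pred g ->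
  convex_pred (fun i => f i && g i).
Proof.
move=> cf cg i j k ijk /andP[fi gi] /andP[fk gk].
by rewrite (cf i j k) // (cg i j k).
Qed.

Lemma eq_convex_pred (f g : nat -> bool) : f =1 g -> convex_pred f -> convex_pred g.
Proof. by move=> fg cf i j k ijk; rewrite -!fg; apply: cf. Qed.

Lemma ccw_biconvex (R : realType) (P S T : R * R) :
  biconvex_pred (fun i j => ccw P (i%:R, j%:R) S T).
Proof.
split=> t; rewrite /ccw; (apply: convex_predI; [|apply: convex_predI; [|apply: convex_predI]]).
- apply: (eq_convex_pred _ _ _ (affine_convex R (S.2 - P.2) (- P.1 * (S.2 - P.2) - (t%:R - P.2) * (S.1 - P.1)))) => i.
  by congr (_ < _); rewrite /orient /=; ring.
- apply: (eq_convex_pred _ _ _ (affine_convex R (T.2 - P.2) (- P.1 * (T.2 - P.2) - (t%:R - P.2) * (T.1 - P.1)))) => i.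
  by congr (_ < _); rewrite /orient /=; ring.
- apply: (eq_convex_pred _ _ _ (affine_convex R (S.2 - T.2) (S.1 * (T.2 - t%:R) - (S.2 - t%:R) * T.1))) => i.
  by congr (_ < _); rewrite /orient /=; ring.
- by [].
- apply: (eq_convex_pred _ _ _ (affine_convex R (- (S.1 - P.1)) ((t%:R - P.1) * (S.2 - P.2) + P.2 * (S.1 - P.1)))) => i.
  by congr (_ < _); rewrite /orient /=; ring.
- apply: (eq_convex_pred _ _ _ (affine_convex R (- (T.1 - P.1)) ((t%:R - P.1) * (T.2 - P.2) + P.2 * (T.1 - P.1)))) => i.
  by congr (_ < _); rewrite /orient /=; ring.
- apply: (eq_convex_pred _ _ _ (affine_convex R (T.1 - S.1) ((S.1 - t%:R) * T.2 - S.2 * (T.1 - t%:R)))) => i.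
  by congr (_ < _); rewrite /orient /=; ring.
- by [].
Qed.

(** If g is the gcd, dividing B - A by g gives a lattice point of the segment at parameter 1/g,
    which must be B. Conversely, a Bezout relation expresses the parameter of any lattice point of
    the segment as an integer, so it is 0 or 1. *)
Lemma prime_segmentP (R : realType) (A B : int * int) :
  prime_segment R A B <-> gcdz (B.1 - A.1) (B.2 - A.2) = 1.
Proof.
case: A B => [a1 a2] [b1 b2] /=; set u := b1 - a1; set v := b2 - a2.
have b1E : b1 = a1 + u by rewrite /u; ring.
have b2E : b2 = a2 + v by rewrite /v; ring.
clearbody u v; subst b1 b2.
split=> [[AB seg]|g1].
  have [g g0 [u' [v' [gE uE vE]]]] : exists2 g : int, 0 <= g & exists u' v' : int,
      [/\ gcdz u v = g, u = u' * g & v = v' * g].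
    exists (gcdz u v) => //; exists (u %/ gcdz u v)%Z, (v %/ gcdz u v)%Z.
    by rewrite !divzK ?dvdz_gcdl ?dvdz_gcdr.
  have uv0 : ~ (u' = 0 /\ v' = 0).
    by case=> u0 v0; apply: AB; rewrite uE vE u0 v0 !mul0r !addr0.
  have gn0 : g != 0.
    by apply/eqP => g00; apply: AB; rewrite uE vE g00 !mulr0 !addr0.
  have g1 : 1 <= g by lia.
  have gr1 : 1 <= g%:~R :> R by rewrite ler1z.
  have [|[E1 E2]|[E1 E2]] := seg (a1 + u', a2 + v').
  - exists (g%:~R^-1); split; [by rewrite invr_ge0; lra|by rewrite invf_le1; lra|].
    by rewrite /int_point uE vE /= !intrD !intrM; congr (_, _); field;
      rewrite lt0r_neq0 //; lra.
  - by case: uv0; lia.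
  - rewrite gE; case: (u' =P 0) => [u0|/eqP u0].
      have v0 : v' != 0 by apply/eqP => v0; apply: uv0.
      by apply: (mulfI v0); rewrite mulr1; lia.
    by apply: (mulfI u0); rewrite mulr1; lia.
have [s [t st]] := Bezoutz u v; rewrite g1 in st.
have AB : (a1, a2) <> (a1 + u, a2 + v).
  case=> E1 E2; have u0 : u = 0 by lia. have v0 : v = 0 by lia.
  by move: g1; rewrite u0 v0.
split=> // -[z1 z2] [x [x0 x1]] [] /=; rewrite !intrD => E1 E2.
pose k := s * (z1 - a1) + t * (z2 - a2).
have kx : k%:~R = x.
  rewrite /k intrD !intrM !intrB E1 E2.
  transitivity (x * (s * u + t * v)%:~R); last by rewrite st mulr1.
  by rewrite intrD !intrM; ring.
rewrite -kx ler0z in x0; rewrite -kx lerz1 in x1.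
have : k = 0 \/ k = 1 by lia.
case=> kE; rewrite -kx kE in E1 E2; [left|right]; congr (_, _); apply: (@intr_inj R);
  rewrite ?E1 ?E2 /=; ring.
Qed.

Lemma prime_grid_segmentP (R : realType) (m n : nat) (a b : 'I_m * 'I_n) :
  prime_segment R (grid_point a) (grid_point b) <->
  point_gcd a.1 a.2 m n b == 1%N.
Proof.
rewrite prime_segmentP /point_gcd /gcdz /=; split=> [[->]|/eqP ->] //.
Qed.

Lemma point_gcdC (m n : nat) (a b : 'I_m * 'I_n) :
  point_gcd a.1 a.2 m n b = point_gcd b.1 b.2 m n a.
Proof. by rewrite /point_gcd distnC [`|b.2 - _|%N]distnC. Qed.

Lemma eq_set2 (T : finType) (a b c d : T) : [set a; b]%SET = [set c; d]%SET ->
  (a = c /\ b = d) \/ (a = d /\ b = c).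
Proof.
move=> E.
have : a \in [set c; d]%SET by rewrite -E set21.
have : b \in [set c; d]%SET by rewrite -E set22.
have : c \in [set a; b]%SET by rewrite E set21.
have : d \in [set a; b]%SET by rewrite E set22.
rewrite !inE.
by do 4! case/orP => /eqP ?; subst; tauto.
Qed.

(** * From pairs of segments to labelled quadruples *)

Definition grid_pt {R : realType} {m n : nat} (a : 'I_m * 'I_n) : R * R :=
  (a.1%:R, a.2%:R).

Definition prime_ccw (R : realType) (m n : nat)
    (q : ('I_m * 'I_n) * ('I_m * 'I_n) * (('I_m * 'I_n) * ('I_m * 'I_n))) : bool :=
  [&& ccw (grid_pt q.1.1 : R * R) (grid_pt q.1.2) (grid_pt q.2.1) (grid_pt q.2.2),
      point_gcd q.1.1.1 q.1.1.2 m n q.1.2 == 1%N &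
      point_gcd q.2.1.1 q.2.1.2 m n q.2.2 == 1%N].

Definition segment_pair (T : finType) (q : (T * T) * (T * T)) : {set {set T}} :=
  [set [set q.1.1; q.1.2]; [set q.2.1; q.2.2]]%SET.

Lemma prime_ccw_swap (R : realType) (m n : nat) q :
  prime_ccw R m n (q.2, q.1) = prime_ccw R m n q.
Proof. by rewrite /prime_ccw /= ccw_rot2; congr (_ && _); rewrite andbC. Qed.

(** Exchanging the ends of one or both segments reverses the turn of some triple, so the orientation
    recovers the labels from the ordered pair of segments. *)
Lemma ccw_same_ends (R : realType) (m n : nat) (a b c d a' b' c' d' : 'I_m * 'I_n) :
  ccw (grid_pt a : R * R) (grid_pt b) (grid_pt c) (grid_pt d) ->
  ccw (grid_pt a' : R * R) (grid_pt b') (grid_pt c') (grid_pt d') ->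
  [set a; b]%SET = [set a'; b']%SET -> [set c; d]%SET = [set c'; d']%SET ->
  ((a', b'), (c', d')) = ((a, b), (c, d)).
Proof.
move=> /and4P[h1 h2 h3 h4] /and4P[h1' h2' h3' h4'].
case/eq_set2 => -[? ?]; case/eq_set2 => -[? ?]; subst=> //; exfalso;
  move: h1 h2 h3 h4 h1' h2' h3' h4'; rewrite /orient /=; lra.
Qed.

Lemma prime_ccw_fibre (R : realType) (m n : nat) q q' :
  prime_ccw R m n q -> prime_ccw R m n q' ->
  segment_pair _ q' = segment_pair _ q -> q' = q \/ q' = (q.2, q.1).
Proof.
case: q q' => [[a b] [c d]] [[a' b'] [c' d']] /and3P[/= k _ _] /and3P[/= k' _ _].
rewrite /segment_pair /= => /esym/eq_set2 [[E1 E2]|[E1 E2]]; [left|right].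
  exact: (ccw_same_ends R _ _ _ _ _ _ _ _ _ _ k k' E1 E2).
by rewrite ccw_rot2 in k; apply: (ccw_same_ends R _ _ _ _ _ _ _ _ _ _ k k').
Qed.

(** Forgetting labels is exactly two-to-one: the fibre of a pair consists of one labelling and the
    one with the two segments exchanged. *)
Lemma pE (R : realType) (m n : nat) :
  (p R m n * 2)%N = #|[set q | prime_ccw R m n q]%SET|.
Proof.
set Q := [set q | _]%SET.
have -> : p R m n = #|[set segment_pair _ q | q in Q]%SET|.
  apply: eq_card => st; rewrite inE; apply/asboolP/imsetP; last first.
    case=> -[[a b] [c d]]; rewrite inE => /and3P[/= k ab cd] ->.
    exists [set a; b]%SET, [set c; d]%SET; split=> //.
    - by exists a, b; split=> //; apply/prime_grid_segmentP.
    - by exists c, d; split=> //; apply/prime_grid_segmentP.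
    - exists a, b, c, d; split=> //; rewrite convex_quadrilateralE; apply/orP; left.
      exact: k.
  move=> [s [t [-> [a' [b' [-> ab]]] [c' [d' [-> cd]]] [a [b [c [d [/esym E1 /esym E2 k]]]]]]]].
  have {}ab : point_gcd a.1 a.2 m n b == 1%N.
    move/prime_grid_segmentP: ab.
    by case/eq_set2: (E1) => -[-> ->] //; rewrite point_gcdC.
  have {}cd : point_gcd c.1 c.2 m n d == 1%N.
    move/prime_grid_segmentP: cd.
    by case/eq_set2: (E2) => -[-> ->] //; rewrite point_gcdC.
  rewrite -E1 -E2; move: k; rewrite convex_quadrilateralE => /orP[k|k].
    exists ((a, b), (c, d)) => //; rewrite inE /prime_ccw /= ab cd !andbT.
    exact: k.
  (* A clockwise quadrilateral is read backwards. *)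
  exists ((d, c), (b, a)).
    rewrite inE /prime_ccw /= point_gcdC cd point_gcdC ab !andbT; exact: k.
  by rewrite /segment_pair /= finset.setUC (finset.setUC [set d]%SET) (finset.setUC [set b]%SET).
rewrite -[RHS]sum1_card (partition_big_imset (segment_pair _)) /=.
rewrite -sum_nat_const; apply: eq_bigr => _ /imsetP[q Qq ->].
have qq' : q != (q.2, q.1).
  case: q Qq => [[a b] [c d]]; rewrite inE => /and3P[/= k _ _].
  by apply/eqP => -[E1 _ _ _]; have [_ _] := ccw_neq _ _ _ _ _ k; rewrite E1 eqxx.
rewrite sum1dep_card -[LHS](_ : #|[set q; (q.2, q.1)]%SET| = 2)%N; last by rewrite cards2 qq'.
apply: eq_card => q'; rewrite !inE; apply/orP/andP.
  case=> /eqP ->; first by rewrite inE in Qq.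
  rewrite prime_ccw_swap; split; first by rewrite inE in Qq.
  by rewrite /segment_pair /= finset.setUC.
rewrite inE in Qq; case=> Qq' /eqP E.
by case: (prime_ccw_fibre R m n q q' Qq Qq' E) => ->; [left|right].
Qed.

Lemma natr_pE (R : realType) (m n : nat) :
  (p R m n)%:R * 2 = \sum_(a : 'I_m * 'I_n) \sum_(b : 'I_m * 'I_n)
    \sum_(c : 'I_m * 'I_n) \sum_(d : 'I_m * 'I_n)
      (ccw (grid_pt a : R * R) (grid_pt b) (grid_pt c) (grid_pt d))%:R *
      ((point_gcd a.1 a.2 m n b == 1%N)%:R * (point_gcd c.1 c.2 m n d == 1%N)%:R) :> R.
Proof.
rewrite -natrM pE -sum1_card big_mkcond natr_sum.
rewrite [RHS]pair_big /=; under [RHS]eq_bigr do rewrite pair_big /=.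
rewrite [RHS]pair_big /=; apply: eq_bigr => -[[a b] [c d]] _ /=.
by rewrite -!natr_andb inE /prime_ccw /=; case: ifP.
Qed.

(** * Mean area of a triangle with vertices on the grid *)

Lemma sum_natr (R : realFieldType) (N : nat) :
  \sum_(i < N) (i%:R : R) = N%:R * (N%:R - 1) / 2.
Proof.
elim: N => [|N IH]; first by rewrite big_ord0 !mul0r.
by rewrite big_ord_recr /= IH -natr1; field.
Qed.

Lemma sum_natr_sqr (R : realFieldType) (N : nat) :
  \sum_(i < N) ((i%:R : R) ^+ 2) = N%:R * (N%:R - 1) * (2 * N%:R - 1) / 6.
Proof.
elim: N => [|N IH]; first by rewrite big_ord0 !mul0r.
by rewrite big_ord_recr /= IH -natr1; field.
Qed.

Lemma sum_quadratic (R : realFieldType) (N : nat) (c0 c1 c2 : R) :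
  \sum_(i < N) (c0 + c1 * i%:R + c2 * i%:R ^+ 2) =
  N%:R * c0 + c1 * (N%:R * (N%:R - 1) / 2)
  + c2 * (N%:R * (N%:R - 1) * (2 * N%:R - 1) / 6).
Proof.
rewrite !big_split /= -!mulr_sumr sum_natr sum_natr_sqr sumr_const card_ord.
by rewrite -[c0 *+ N]mulr_natl.
Qed.

Lemma sum_between (R : pzRingType) (m a b : nat) (g : nat -> R) : (a < b <= m)%N ->
  \sum_(i < m) (a < i < b)%N%:R * g i = \sum_(u < b - a) (0 < u)%N%:R * g (a + u)%N.
Proof.
case/andP=> ab bm.
have am : (a <= m)%N by apply: leq_trans bm; apply: ltnW.
rewrite -(big_mkord xpredT (fun i => (a < i < b)%N%:R * g i)) (big_cat_nat _ am) //=.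
rewrite [X in X + _]big_nat [X in X + _]big1 => [|i /andP[_ ia]]; last first.
  by rewrite (_ : (a < i)%N = false) ?mul0r //; lia.
rewrite add0r (big_cat_nat _ bm) ?(ltnW ab) //=.
rewrite [X in _ + X]big_nat [X in _ + X]big1 => [|i /andP[bi _]]; last first.
  by rewrite (_ : (a < i < b)%N = false) ?mul0r //; lia.
rewrite addr0 -[X in \sum_(X <= i < b) _]add0n big_addn big_mkord; apply: eq_bigr => u _.
rewrite addnC (_ : (a < a + u < b)%N = (0 < u)%N) //; have := ltn_ord u; lia.
Qed.

Lemma count_lt_near (R : realFieldType) (N : nat) (l : R) : 0 <= l <= N%:R ->
  `|\sum_(i < N) (i%:R < l)%R%:R - l| <= 1.
Proof.
move=> /andP[l0 lN].
(* The hypothesis l <= N is not inherited by smaller N, so the induction carries bounds for both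
   cases. *)
suff : [/\ \sum_(i < N) ((i%:R < l)%R%:R : R) <= N%:R,
    \sum_(i < N) (i%:R < l)%R%:R <= l + 1 &
    (N%:R <= l -> N%:R <= \sum_(i < N) ((i%:R < l)%R%:R : R)) /\
    (l <= N%:R -> l <= \sum_(i < N) (i%:R < l)%R%:R)].
  case=> h1 h2 [_ h4]; have h5 := h4 lN; rewrite ler_norml; apply/andP; split; lra.
elim: N {lN} => [|N].
  by rewrite big_ord0; split; [lra|lra|split; lra].
rewrite big_ord_recr /= -natr1; set S := \sum_(i < N) _.
case=> IH1 IH2 [IH3 IH4].
have N0 : 0 <= N%:R :> R by [].
case: (ltrP N%:R l) => h /=.
  have := IH3 (ltW h); split; [lra|lra|split; lra].
by have := IH4 h; split; [lra|lra|split; lra].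
Qed.

(** The quadratic is the integral of |t - l| over [0, N]. It telescopes through the antiderivative
    g, and each unit step is within 1 of its sample. *)
Lemma sum_dist_near (R : realFieldType) (N : nat) (l : R) : 0 <= l <= N%:R ->
  `|\sum_(i < N) `|i%:R - l| - (l ^+ 2 - N%:R * l + N%:R ^+ 2 / 2)| <= N%:R.
Proof.
move=> /andP[l0 lN].
pose g (t : R) := (t - l) * `|t - l| / 2.
have -> : l ^+ 2 - N%:R * l + N%:R ^+ 2 / 2 = \sum_(i < N) (g i.+1%:R - g i%:R).
  rewrite -(big_mkord xpredT (fun i => g i.+1%:R - g i%:R)) telescope_sumr //.
  by rewrite /g sub0r normrN !ger0_norm ?subr_ge0 //; field.
rewrite -sumrB -[leRHS]mulr1 -[X in X%:R * 1]card_ord; apply: norm_sum_le => i.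
rewrite /g -natr1; move: (i%:R) => y.
have -> : y + 1 - l = (y - l) + 1 by ring.
move: (y - l) => z; rewrite ler_norml.
case: (lerP 0 z) => z0.
  by rewrite !ger0_norm ?addr_ge0 //; apply/andP; split; lra.
case: (lerP 0 (z + 1)) => z1.
  by rewrite (ger0_norm z1) (ltr0_norm z0); apply/andP; split; nra.
by rewrite !ltr0_norm //; apply/andP; split; lra.
Qed.

(** For independent uniform i, j in [0,1] and l = (1-x) i + x j, the mean of l is 1/2 and that of
    l^2 is 1/3 - x(1-x)/6; the other two terms cancel on average. *)
Lemma sum_dist_quadratic (R : realFieldType) (n : nat) (x : R) : 0 <= x <= 1 ->
  `|\sum_(i < n) \sum_(j < n) (((1 - x) * i%:R + x * j%:R) ^+ 2
      - n%:R * ((1 - x) * i%:R + x * j%:R) + n%:R ^+ 2 / 2)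
    - n%:R ^+ 4 * (1 / 3 - x * (1 - x) / 6)| <= 3 * n%:R ^+ 3.
Proof.
move=> /andP[x0 x1].
have -> : \sum_(i < n) \sum_(j < n) (((1 - x) * i%:R + x * j%:R) ^+ 2
      - n%:R * ((1 - x) * i%:R + x * j%:R) + n%:R ^+ 2 / 2) =
   \sum_(i < n) ((1 - x) ^+ 2 * n%:R * i%:R ^+ 2 + 2 * x * (1 - x) * (n%:R * (n%:R - 1) / 2) * i%:R
     + x ^+ 2 * (n%:R * (n%:R - 1) * (2 * n%:R - 1) / 6) - n%:R ^+ 2 * (1 - x) * i%:R
     - n%:R * x * (n%:R * (n%:R - 1) / 2) + n%:R ^+ 3 / 2).
  apply: eq_bigr => i _.
  transitivity (\sum_(j < n) (((1 - x) ^+ 2 * i%:R ^+ 2 - n%:R * (1 - x) * i%:R + n%:R ^+ 2 / 2)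
    + (2 * x * (1 - x) * i%:R - n%:R * x) * j%:R + x ^+ 2 * j%:R ^+ 2)).
    by apply: eq_bigr => j _; ring.
  rewrite sum_quadratic.
  by field.
have -> : \sum_(i < n) ((1 - x) ^+ 2 * n%:R * i%:R ^+ 2 + 2 * x * (1 - x) * (n%:R * (n%:R - 1) / 2) * i%:R
     + x ^+ 2 * (n%:R * (n%:R - 1) * (2 * n%:R - 1) / 6) - n%:R ^+ 2 * (1 - x) * i%:R
     - n%:R * x * (n%:R * (n%:R - 1) / 2) + n%:R ^+ 3 / 2) =
   ((1 - x) ^+ 2 + x ^+ 2) * n%:R * (n%:R * (n%:R - 1) * (2 * n%:R - 1) / 6)
   + 2 * x * (1 - x) * (n%:R * (n%:R - 1) / 2) ^+ 2
   - n%:R ^+ 2 * (n%:R * (n%:R - 1) / 2) + n%:R ^+ 4 / 2.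
  transitivity (\sum_(i < n) ((x ^+ 2 * (n%:R * (n%:R - 1) * (2 * n%:R - 1) / 6)
     - n%:R * x * (n%:R * (n%:R - 1) / 2) + n%:R ^+ 3 / 2)
     + (2 * x * (1 - x) * (n%:R * (n%:R - 1) / 2) - n%:R ^+ 2 * (1 - x)) * i%:R
     + (1 - x) ^+ 2 * n%:R * i%:R ^+ 2)).
    by apply: eq_bigr => i _; ring.
  rewrite sum_quadratic.
  by field.
have [->|n0] := posnP n; first by rewrite ler_norml; apply/andP; split; lra.
have n1 : 1 <= n%:R :> R by rewrite ler1n.
move: (n%:R) n1 => y y1.
pose w : R := x * (1 - x).
have w0 : 0 <= w by rewrite mulr_ge0 //; lra.
have w1 : w <= 1 by rewrite /w; nra.
have -> : ((1 - x) ^+ 2 + x ^+ 2) * y * (y * (y - 1) * (2 * y - 1) / 6) +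
   2 * x * (1 - x) * (y * (y - 1) / 2) ^+ 2 - y ^+ 2 * (y * (y - 1) / 2) + y ^+ 4 / 2 -
   y ^+ 4 * (1 / 3 - x * (1 - x) / 6) = y ^+ 2 * ((1 - 2 * w) * (1 - 3 * y) / 6
     + w * (1 - 2 * y) / 2 + y / 2).
  by rewrite /w; field.
have -> : 3 * y ^+ 3 = y ^+ 2 * (3 * y) by ring.
rewrite normrM ger0_norm ?sqr_ge0 // ler_wpM2l ?sqr_ge0 // ler_norml; apply/andP; split; nra.
Qed.

(** By symmetry this is half of the unrestricted double sum. *)
Lemma sum_lt_sqr_dist (R : realFieldType) (m : nat) :
  \sum_(i < m) \sum_(k < m) (i < k)%N%:R * (k%:R - i%:R) ^+ 2
  = m%:R ^+ 2 * (m%:R ^+ 2 - 1) / 12 :> R.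
Proof.
set D := \sum_(i < m) _.
have D2 : D + D = \sum_(i < m) \sum_(k < m) (k%:R - i%:R) ^+ 2.
  rewrite {1}/D exchange_big -big_split; apply: eq_bigr => i _ /=.
  rewrite -big_split; apply: eq_bigr => k _ /=.
  by case: ltngtP => [_|_|->] /=; ring.
have : D + D = m%:R ^+ 2 * (m%:R ^+ 2 - 1) / 6; last by lra.
rewrite D2.
transitivity (\sum_(i < m) ((m%:R * (m%:R - 1) * (2 * m%:R - 1) / 6)
  + (- (m%:R * (m%:R - 1))) * i%:R + m%:R * i%:R ^+ 2 : R)).
  apply: eq_bigr => i _.
  transitivity (\sum_(k < m) (i%:R ^+ 2 + (- 2 * i%:R) * k%:R + 1 * k%:R ^+ 2 : R)).
    by apply: eq_bigr => k _; ring.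
  by rewrite sum_quadratic; field.
by rewrite sum_quadratic; field.
Qed.

(** The mean of x(1-x) over [0,1] is 1/6, so the bracket averages to 1/3 - 1/36 = 11/36. *)
Lemma sum_middle_column (R : realFieldType) (m i k : nat) (w : R) :
  (i < k <= m)%N -> w = k%:R - i%:R ->
  `|\sum_(j < m) (i < j < k)%N%:R * (w * (1 / 3 -
      (j%:R - i%:R) / w * (1 - (j%:R - i%:R) / w) / 6)) - 11 / 36 * w ^+ 2| <= w.
Proof.
move=> ikm wki; have /andP[ik _] := ikm.
have wE : w = (k - i)%:R by rewrite natrB // ltnW.
have w1 : 1 <= w by rewrite wE ler1n subn_gt0.
have w0 : w != 0 by rewrite gt_eqF //; lra.
rewrite (sum_between _ m i k (fun j => w * (1 / 3 -
      (j%:R - i%:R) / w * (1 - (j%:R - i%:R) / w) / 6)) ikm).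
(* The term u = 0 is added to obtain a full quadratic sum; its value w/3 is subtracted again. *)
have -> : \sum_(u < k - i) (0 < u)%N%:R * (w * (1 / 3 -
      ((i + u)%:R - i%:R) / w * (1 - ((i + u)%:R - i%:R) / w) / 6)) =
   \sum_(u < k - i) (w / 3 + (- (1 / 6)) * u%:R + (1 / (6 * w)) * u%:R ^+ 2) - w / 3.
  case: (k - i)%N ik (subn_gt0 i k) => [|W] ik; first by rewrite ik.
  move=> _; rewrite [LHS]big_ord_recl [in RHS]big_ord_recl /= mul0r add0r.
  rewrite [RHS](_ : _ = \sum_(u < W) (w / 3 + (- (1 / 6)) * (bump 0 u)%:R
     + (1 / (6 * w)) * (bump 0 u)%:R ^+ 2)); last by field.
  by apply: eq_bigr => u _; rewrite mul1r natrD; field.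
rewrite sum_quadratic -wE ler_norml.
have -> : w * (w / 3) + - (1 / 6) * (w * (w - 1) / 2)
  + 1 / (6 * w) * (w * (w - 1) * (2 * w - 1) / 6) - w / 3 - 11 / 36 * w ^+ 2
  = 1 / 36 - w / 3 by field.
by apply/andP; split; lra.
Qed.

(** Twice the area is the width w times the vertical distance from the middle vertex to the opposite
    side, whose height in column j is [l a c]. Summing over b, then over a and c, gives errors w n^3
    and 3 w n^3. *)
Lemma sum_orient_columns (R : realType) (n i j k : nat) (w x : R) :
  (i < j < k)%N -> w = k%:R - i%:R -> x = (j%:R - i%:R) / w ->
  `|\sum_(a < n) \sum_(c < n) \sum_(b < n)
      `|orient (i%:R, a%:R) (j%:R, b%:R) (k%:R, c%:R) : R|
   - n%:R ^+ 4 * (w * (1 / 3 - x * (1 - x) / 6))| <= 4 * w * n%:R ^+ 3.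
Proof.
move=> /andP[ij jk] wE xE.
have ir : i%:R < j%:R :> R by rewrite ltr_nat.
have jr : j%:R < k%:R :> R by rewrite ltr_nat.
have w0 : 0 < w by lra.
have x01 : 0 <= x <= 1.
  by rewrite xE divr_ge0 ?ler_pdivrMr ?mul1r //; lra.
have /andP[x0 x1] := x01.
pose l (a c : 'I_n) := (1 - x) * a%:R + x * c%:R : R.
pose Q (a c : 'I_n) := l a c ^+ 2 - n%:R * l a c + n%:R ^+ 2 / 2.
have col (a c : 'I_n) : `|\sum_(b < n)
    `|orient (i%:R, a%:R) (j%:R, b%:R) (k%:R, c%:R) : R| - w * Q a c| <= w * n%:R.
  have -> : \sum_(b < n) `|orient (i%:R, a%:R) (j%:R, b%:R) (k%:R, c%:R) : R|
      = w * \sum_(b < n) `|b%:R - l a c|.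
    rewrite mulr_sumr; apply: eq_bigr => b _.
    rewrite -[X in X * _](gtr0_norm w0) -normrM -normrN; congr `|_|.
    by rewrite /orient /l xE /= -wE; field; rewrite lt0r_neq0.
  rewrite -mulrBr normrM (gtr0_norm w0) ler_wpM2l ?(ltW w0) //.
  apply: sum_dist_near; rewrite /l.
  have a1 : a%:R <= n%:R :> R by rewrite ler_nat ltnW.
  have c1 : c%:R <= n%:R :> R by rewrite ler_nat ltnW.
  apply/andP; split; first by rewrite addr_ge0 ?mulr_ge0 //; lra.
  have := ler_wpM2l x0 c1; have x10 : 0 <= 1 - x by lra.
  by have := ler_wpM2l x10 a1; lra.
have h2 := sum_dist_quadratic R n x x01.
have h1 : `|\sum_(a < n) \sum_(c < n) (\sum_(b < n)
      `|orient (i%:R, a%:R) (j%:R, b%:R) (k%:R, c%:R) : R| - w * Q a c)|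
     <= n%:R * (n%:R * (w * n%:R)).
  rewrite -[X in _ <= X%:R * (_ * _)]card_ord; apply: norm_sum_le => a.
  by rewrite -[X in X%:R * (w * _)]card_ord; apply: norm_sum_le => c.
move: h1; under eq_bigr do rewrite sumrB -mulr_sumr.
rewrite sumrB -mulr_sumr => h1.
set S := \sum_(a < n) _ in h1 *.
set q := \sum_(a < n) _ in h1; set r := n%:R ^+ 4 * _ in h2 .
have {}h2 : `|q - r| <= 3 * n%:R ^+ 3 by [].
have -> : S - n%:R ^+ 4 * (w * (1 / 3 - x * (1 - x) / 6)) = (S - w * q) + w * (q - r).
  by rewrite /r; ring.
apply: (le_trans (ler_normD _ _)); rewrite [X in _ + X]normrM (gtr0_norm w0).
have -> : 4 * w * n%:R ^+ 3 = n%:R * (n%:R * (w * n%:R)) + w * (3 * n%:R ^+ 3) by ring.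
by rewrite lerD // ler_wpM2l ?(ltW w0).
Qed.

(** The constant is 11/36 from the middle column times 1/12 from the squared widths. *)
Lemma sum_sorted_orient_near (R : realType) (m n : nat) :
  `|\sum_(i < m) \sum_(k < m) \sum_(j < m) (i < j < k)%N%:R *
     (\sum_(a < n) \sum_(c < n) \sum_(b < n)
      `|orient (i%:R, a%:R) (j%:R, b%:R) (k%:R, c%:R) : R|)
    - 11 / 432 * (m%:R ^+ 4 * n%:R ^+ 4)| <= 4 * (m%:R ^+ 3 * n%:R ^+ 3 * (m%:R + n%:R)).
Proof.
pose V (i j k : nat) : R := \sum_(a < n) \sum_(c < n) \sum_(b < n)
      `|orient (i%:R, a%:R) (j%:R, b%:R) (k%:R, c%:R) : R|.
pose w (i k : nat) : R := k%:R - i%:R.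
pose f (i j k : nat) := w i k * (1 / 3 -
      (j%:R - i%:R) / w i k * (1 - (j%:R - i%:R) / w i k) / 6).
have h1 : `|\sum_(i < m) \sum_(k < m) \sum_(j < m) ((i < j < k)%N%:R *
     (V i j k - n%:R ^+ 4 * f i j k))| <= m%:R * (m%:R * (m%:R * (4 * m%:R * n%:R ^+ 3))).
  rewrite -[X in X%:R * _]card_ord; apply: norm_sum_le => i.
  rewrite -[X in _ <= X%:R * (_ * _)]card_ord; apply: norm_sum_le => k.
  rewrite -[X in X%:R * (4 * _ * _)]card_ord; apply: norm_sum_le => j.
  case: (boolP (i < j < k)%N) => [ijk|_]; last first.
    by rewrite mul0r normr0 !mulr_ge0 ?exprn_ge0.
  rewrite mul1r; apply: (le_trans (sum_orient_columns R n i j k _ _ ijk erefl erefl)).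
  rewrite ler_wpM2r ?exprn_ge0 // ler_wpM2l //.
  have : k%:R <= m%:R :> R by rewrite ler_nat ltnW.
  have : 0 <= i%:R :> R by []. lra.
have h2 : `|\sum_(i < m) \sum_(k < m) ((\sum_(j < m) (i < j < k)%N%:R * f i j k)
    - 11 / 36 * ((i < k)%N%:R * w i k ^+ 2))| <= m%:R * (m%:R * m%:R).
  rewrite -[X in _ <= X%:R * (_ * _)]card_ord; apply: norm_sum_le => i.
  rewrite -[X in _ <= X%:R * _]card_ord; apply: norm_sum_le => k.
  case: (ltnP i k) => ik; last first.
    rewrite big1 => [|j _]; first by rewrite mul0r mulr0 subr0 normr0.
    by rewrite (_ : (i < j < k)%N = false) ?mul0r //; lia.
  rewrite mul1r; apply: (le_trans (sum_middle_column R m i k _ _ erefl)).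
    by rewrite ik ltnW.
  have : k%:R <= m%:R :> R by rewrite ler_nat ltnW.
  have : 0 <= i%:R :> R by []. lra.
have h3 := sum_lt_sqr_dist R m.
set S := \sum_(i < m) _.
pose F := \sum_(i < m) \sum_(k < m) \sum_(j < m) (i < j < k)%N%:R * f i j k.
pose W := \sum_(i < m) \sum_(k < m) (i < k)%N%:R * w i k ^+ 2.
have e1 : \sum_(i < m) \sum_(k < m) \sum_(j < m) ((i < j < k)%N%:R *
     (V i j k - n%:R ^+ 4 * f i j k)) = S - n%:R ^+ 4 * F.
  rewrite /F mulr_sumr -sumrB; apply: eq_bigr => i _.
  rewrite mulr_sumr -sumrB; apply: eq_bigr => k _.
  rewrite mulr_sumr -sumrB; apply: eq_bigr => j _.
  by rewrite -/(V i j k); ring.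
have e2 : \sum_(i < m) \sum_(k < m) ((\sum_(j < m) (i < j < k)%N%:R * f i j k)
    - 11 / 36 * ((i < k)%N%:R * w i k ^+ 2)) = F - 11 / 36 * W.
  rewrite /W mulr_sumr -sumrB; apply: eq_bigr => i _.
  by rewrite mulr_sumr -sumrB; apply: eq_bigr => k _.
rewrite {}e1 in h1; rewrite {}e2 in h2; rewrite -/W in h3.
clearbody S F; move: {V} (W) h3 h1 h2 => {}W h3 h1 h2.
have m23 : m%:R ^+ 2 <= m%:R ^+ 3 :> R.
  by rewrite -!natrX ler_nat; case: (m) => // k; rewrite leq_pexp2l.
move: (m%:R) (n%:R : R) m23 (ler0n R m) (ler0n R n) h1 h2 h3 => a b a23 a0 b0 h1 h2 h3.
have -> : S - 11 / 432 * (a ^+ 4 * b ^+ 4) =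
  (S - b ^+ 4 * F) + b ^+ 4 * (F - 11 / 36 * W) - 11 / 432 * (a ^+ 2 * b ^+ 4).
  by rewrite h3; field.
have h4 : `|b ^+ 4 * (F - 11 / 36 * W)| <= b ^+ 4 * (a * (a * a)).
  by rewrite normrM ger0_norm ?exprn_ge0 // ler_wpM2l ?exprn_ge0.
have h5 : `|11 / 432 * (a ^+ 2 * b ^+ 4)| <= a ^+ 3 * b ^+ 4.
  have ab1 : a ^+ 2 * b ^+ 4 <= a ^+ 3 * b ^+ 4 by rewrite ler_wpM2r ?exprn_ge0.
  have ab0 : 0 <= a ^+ 2 * b ^+ 4 by rewrite mulr_ge0 ?exprn_ge0.
  rewrite ler_norml; apply/andP; split; lra.
apply: (le_trans (ler_normB _ _)); apply: (le_trans (lerD (ler_normD _ _) (lexx _))).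
have : 0 <= a ^+ 3 * b ^+ 4 by rewrite mulr_ge0 ?exprn_ge0.
lra.
Qed.

(** * Lattice points of a triangle by winding numbers *)

(** The signed crossing of the edge PQ with the vertical ray going up from X: +1 if the edge passes
    above X from left to right, -1 from right to left. The columns of P and Q are excluded. *)
Definition col_cross {R : realType} (P Q X : R * R) : R :=
  ((P.1 < X.1 < Q.1) && (orient P Q X < 0))%R%:R
  - ((Q.1 < X.1 < P.1) && (0 < orient P Q X))%R%:R.

Definition in_ccw {R : realType} (P Q S X : R * R) : bool :=
  [&& 0 < orient P Q X, 0 < orient Q S X & 0 < orient S P X].

Definition in_cw {R : realType} (P Q S X : R * R) : bool :=
  [&& orient P Q X < 0, orient Q S X < 0 & orient S P X < 0].

Definition in_triangle {R : realType} (P Q S X : R * R) : bool :=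
  in_ccw P Q S X || in_cw P Q S X.

Lemma lt0_neq0 (R : realDomainType) (x : R) : x != 0 -> (x < 0) = ~~ (0 < x).
Proof. by move=> x0; rewrite -leNgt le_eqVlt (negbTE x0). Qed.

Lemma mulr_gt0_neq0 (R : realDomainType) (x y : R) : x != 0 -> y != 0 ->
  (0 < x * y) = ((0 < x) == (0 < y)).
Proof.
move=> x0 y0; case: (ltrgtP x 0) x0 => // xs _.
  by rewrite nmulr_rgt0 // lt0_neq0 //; case: (0 < y).
by rewrite pmulr_rgt0 //; case: (0 < y).
Qed.

(* The signed number of edges met by the vertical ray above X is the winding
   number of the triangle around X; the linear relation between the abscissas
   and the areas rules out the inconsistent sign patterns. *)
Lemma winding (R : realType) (P Q S X : R * R) :
  P.1 != X.1 -> Q.1 != X.1 -> S.1 != X.1 ->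
  orient P Q X != 0 -> orient Q S X != 0 -> orient S P X != 0 ->
  col_cross P Q X + col_cross Q S X + col_cross S P X
  = (in_cw P Q S X)%:R - (in_ccw P Q S X)%:R.
Proof.
move=> hP hQ hS hA hB hC; rewrite /col_cross /in_cw /in_ccw.
have rel : (P.1 - X.1) * orient Q S X + (Q.1 - X.1) * orient S P X
   + (S.1 - X.1) * orient P Q X = 0 by rewrite /orient; ring.
rewrite -!(subr_lt0 X.1).
rewrite -!(subr_gt0 X.1).
rewrite -subr_eq0 in hP; rewrite -subr_eq0 in hQ; rewrite -subr_eq0 in hS.
move: (P.1 - X.1) (Q.1 - X.1) (S.1 - X.1) hP hQ hS rel => p q s hp hq hs.
move: (orient P Q X) (orient Q S X) (orient S P X) hA hB hC => A B C hA hB hC rel.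
have n1 : ~~ [&& (0 < p) == (0 < B), (0 < q) == (0 < C) & (0 < s) == (0 < A)].
  apply/negP; rewrite -!mulr_gt0_neq0 // => /and3P[h1 h2 h3]; lra.
have n2 : ~~ [&& (0 < p) != (0 < B), (0 < q) != (0 < C) & (0 < s) != (0 < A)].
  apply/negP; rewrite -!mulr_gt0_neq0 // -!leNgt => /and3P[h1 h2 h3].
  have : p * B != 0 by rewrite mulf_neq0.
  by rewrite neq_lt => /orP[]; lra.
rewrite !lt0_neq0 //; move: n1 n2.
by case: (0 < p); case: (0 < q); case: (0 < s); case: (0 < A); case: (0 < B);
  case: (0 < C) => //= _ _; ring.
Qed.

Lemma col_crossN (R : realType) (P Q X : R * R) : col_cross Q P X = - col_cross P Q X.
Proof. by rewrite /col_cross (orient_swap R P Q X) oppr_lt0 oppr_gt0 opprB. Qed.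

(** Column by column this counts the grid points below the edge, with error 1 each. The heights add
    up to the trapezoid under the edge, less the mean height (a.2 + b.2)/2 because both end columns
    are excluded. *)
Lemma sum_col_cross_lt (R : realType) (m n : nat) (a b : 'I_m * 'I_n) : (a.1 < b.1)%N ->
  `|\sum_(d : 'I_m * 'I_n) col_cross (grid_pt a : R * R) (grid_pt b) (grid_pt d)
    - (b.1%:R - a.1%:R) * (a.2%:R + b.2%:R) / 2| <= m%:R + n%:R.
Proof.
move=> ab; have abr : a.1%:R < b.1%:R :> R by rewrite ltr_nat.
pose w : R := b.1%:R - a.1%:R; have w0 : 0 < w by rewrite subr_gt0.
pose l (i : nat) : R := a.2%:R + (b.2%:R - a.2%:R) / w * (i%:R - a.1%:R).
have -> : \sum_(d : 'I_m * 'I_n) col_cross (grid_pt a : R * R) (grid_pt b) (grid_pt d)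
   = \sum_(i < m) (a.1 < i < b.1)%N%:R * \sum_(j < n) (j%:R < l i)%R%:R.
  rewrite (sum_pointE _ _ _ (fun i j => col_cross (grid_pt a : R * R) (grid_pt b) (grid_pt (i, j)))).
  apply: eq_bigr => i _; rewrite mulr_sumr; apply: eq_bigr => j _.
  rewrite /col_cross /= !ltr_nat.
  rewrite (_ : (b.1 < i < a.1)%N = false) /= ?subr0; last by lia.
  rewrite natr_andb; congr (_ * _%:R); congr nat_of_bool.
  have -> : orient (grid_pt a) (grid_pt b) (grid_pt (i, j)) = w * (j%:R - l i) :> R.
    by rewrite /orient /l /grid_pt /= -/w; field; rewrite lt0r_neq0.
  by rewrite pmulr_rlt0 // subr_lt0.
have h1 : `|\sum_(i < m) (a.1 < i < b.1)%N%:R * (\sum_(j < n) (j%:R < l i)%R%:R - l i)|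
   <= m%:R.
  rewrite -[leRHS]mulr1 -[X in _ <= X%:R * _]card_ord; apply: norm_sum_le => i.
  case: (boolP (a.1 < i < b.1)%N) => [/andP[ai ib]|_]; last by rewrite mul0r normr0.
  rewrite mul1r; apply: count_lt_near.
  have air : a.1%:R < i%:R :> R by rewrite ltr_nat.
  have ibr : i%:R < b.1%:R :> R by rewrite ltr_nat.
  have a2 : a.2%:R <= n%:R :> R by rewrite ler_nat ltnW.
  have b2 : b.2%:R <= n%:R :> R by rewrite ler_nat ltnW.
  pose t : R := (i%:R - a.1%:R) / w.
  have t0 : 0 <= t by rewrite divr_ge0 // ?ltW // subr_gt0.
  have t1 : 0 <= 1 - t by rewrite subr_ge0 ler_pdivrMr // mul1r /w; lra.
  have -> : l i = (1 - t) * a.2%:R + t * b.2%:R.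
    by rewrite /l /t; field; rewrite lt0r_neq0.
  clearbody t; rewrite addr_ge0 ?mulr_ge0 //=.
  have := ler_wpM2l t1 a2; have := ler_wpM2l t0 b2; lra.
have h2 : \sum_(i < m) (a.1 < i < b.1)%N%:R * l i = (w - 1) * (a.2%:R + b.2%:R) / 2.
  rewrite sum_between ?ab 1?ltnW //.
  have wE : w = (b.1 - a.1)%:R by rewrite natrB // ltnW.
  have -> : \sum_(u < b.1 - a.1) (0 < u)%N%:R * l (a.1 + u)%N =
     \sum_(u < b.1 - a.1) (a.2%:R + (b.2%:R - a.2%:R) / w * u%:R + 0 * u%:R ^+ 2) - a.2%:R.
    case: (b.1 - a.1)%N (subn_gt0 a.1 b.1) => [|W]; first by rewrite ab.
    move=> _; rewrite [LHS]big_ord_recl [in RHS]big_ord_recl /= mul0r add0r.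
    rewrite [RHS](_ : _ = \sum_(u < W) (a.2%:R + (b.2%:R - a.2%:R) / w * (bump 0 u)%:R
       + 0 * (bump 0 u)%:R ^+ 2)); last by ring.
    by apply: eq_bigr => u _; rewrite mul1r /l natrD; ring.
  by rewrite sum_quadratic -wE; field; rewrite lt0r_neq0.
rewrite -/w [X in `|X|](_ : _ = \sum_(i < m) (a.1 < i < b.1)%N%:R * (\sum_(j < n) (j%:R < l i)%R%:R - l i)
    - (a.2%:R + b.2%:R) / 2); last first.
  under [in RHS]eq_bigr do rewrite mulrBr.
  by rewrite sumrB h2; field.
apply: (le_trans (ler_normB _ _)); apply: lerD => //.
rewrite ger0_norm ?divr_ge0 ?addr_ge0 //.
have : a.2%:R <= n%:R :> R by rewrite ler_nat ltnW.
have : b.2%:R <= n%:R :> R by rewrite ler_nat ltnW.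
lra.
Qed.

Lemma sum_col_cross_near (R : realType) (m n : nat) (a b : 'I_m * 'I_n) :
  `|\sum_(d : 'I_m * 'I_n) col_cross (grid_pt a : R * R) (grid_pt b) (grid_pt d)
    - (b.1%:R - a.1%:R) * (a.2%:R + b.2%:R) / 2| <= m%:R + n%:R.
Proof.
case: (ltngtP a.1 b.1) => ab; first exact: sum_col_cross_lt.
  under eq_bigr do rewrite col_crossN.
  rewrite sumrN -normrN (_ : - (- _ - _) =
    \sum_(d : 'I_m * 'I_n) col_cross (grid_pt b : R * R) (grid_pt a) (grid_pt d)
    - (a.1%:R - b.1%:R) * (b.2%:R + a.2%:R) / 2); first exact: sum_col_cross_lt.
  by ring.
rewrite ab subrr !mul0r subr0 big1 ?normr0 ?addr_ge0 // => d _.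
rewrite /col_cross /= ab !ltr_nat (_ : (b.1 < d.1 < b.1)%N = false) ?subr0 //.
lia.
Qed.

(** * Sums over triples and quadruples of points *)

Definition sum3 {V : nmodType} {T : finType} (F : T -> T -> T -> V) : V :=
  \sum_(a : T) \sum_(b : T) \sum_(c : T) F a b c.

Definition sum4 {V : nmodType} {T : finType} (F : T -> T -> T -> T -> V) : V :=
  \sum_(a : T) sum3 (F a).

Lemma sum3_swap12 (V : nmodType) (T : finType) (F : T -> T -> T -> V) :
  sum3 (fun a b => F b a) = sum3 F.
Proof. exact: exchange_big. Qed.

Lemma sum3_swap23 (V : nmodType) (T : finType) (F : T -> T -> T -> V) :
  sum3 (fun a b c => F a c b) = sum3 F.
Proof. by apply: eq_bigr => a _; exact: exchange_big. Qed.

Lemma sum4_swap12 (V : nmodType) (T : finType) (F : T -> T -> T -> T -> V) :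
  sum4 (fun a b => F b a) = sum4 F.
Proof. exact: exchange_big. Qed.

Lemma sum4_swap23 (V : nmodType) (T : finType) (F : T -> T -> T -> T -> V) :
  sum4 (fun a b c => F a c b) = sum4 F.
Proof. by apply: eq_bigr => a _; exact: sum3_swap12. Qed.

Lemma sum4_swap34 (V : nmodType) (T : finType) (F : T -> T -> T -> T -> V) :
  sum4 (fun a b c d => F a b d c) = sum4 F.
Proof. by apply: eq_bigr => a _; exact: sum3_swap23. Qed.

Lemma sum3D (V : nmodType) (T : finType) (F G : T -> T -> T -> V) :
  sum3 (fun a b c => F a b c + G a b c) = sum3 F + sum3 G.
Proof.
rewrite /sum3 -big_split; apply: eq_bigr => a _ /=.
by rewrite -big_split; apply: eq_bigr => b _ /=; rewrite -big_split.
Qed.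

Lemma sum4D (V : nmodType) (T : finType) (F G : T -> T -> T -> T -> V) :
  sum4 (fun a b c d => F a b c d + G a b c d) = sum4 F + sum4 G.
Proof.
by rewrite /sum4 -big_split; apply: eq_bigr => a _; exact: sum3D.
Qed.

Lemma sum3B (V : zmodType) (T : finType) (F G : T -> T -> T -> V) :
  sum3 (fun a b c => F a b c - G a b c) = sum3 F - sum3 G.
Proof.
rewrite /sum3 -sumrB; apply: eq_bigr => a _.
by rewrite -sumrB; apply: eq_bigr => b _; rewrite -sumrB.
Qed.

Lemma sum4B (V : zmodType) (T : finType) (F G : T -> T -> T -> T -> V) :
  sum4 (fun a b c d => F a b c d - G a b c d) = sum4 F - sum4 G.
Proof.
by rewrite /sum4 -sumrB; apply: eq_bigr => a _; exact: sum3B.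
Qed.

Lemma sum3_mull (R : pzSemiRingType) (T : finType) (k : R) (F : T -> T -> T -> R) :
  sum3 (fun a b c => k * F a b c) = k * sum3 F.
Proof.
rewrite /sum3 mulr_sumr; apply: eq_bigr => a _.
by rewrite mulr_sumr; apply: eq_bigr => b _; rewrite mulr_sumr.
Qed.

Lemma sum4_mull (R : pzSemiRingType) (T : finType) (k : R) (F : T -> T -> T -> T -> R) :
  sum4 (fun a b c d => k * F a b c d) = k * sum4 F.
Proof.
by rewrite /sum4 mulr_sumr; apply: eq_bigr => a _; exact: sum3_mull.
Qed.

Lemma sum3_const (R : pzSemiRingType) (T : finType) (k : R) :
  sum3 (fun _ _ _ : T => k) = #|T|%:R ^+ 3 * k.
Proof.
rewrite /sum3 !sumr_const -!mulrnA -[k *+ _]mulr_natl -natrX.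
by congr (_%:R * _); rewrite !expnS muln1 mulnA.
Qed.

Lemma sum4_const (R : pzSemiRingType) (T : finType) (k : R) :
  sum4 (fun _ _ _ _ : T => k) = #|T|%:R ^+ 4 * k.
Proof. by rewrite /sum4 sum3_const sumr_const -[_ *+ _]mulr_natl mulrA -exprS. Qed.

Lemma sum3_norm_le (R : numDomainType) (T : finType) (F G : T -> T -> T -> R) :
  (forall a b c, `|F a b c| <= G a b c) -> `|sum3 F| <= sum3 G.
Proof.
move=> FG; apply: (le_trans (ler_norm_sum _ _ _)); apply: ler_sum => a _.
apply: (le_trans (ler_norm_sum _ _ _)); apply: ler_sum => b _.
by apply: (le_trans (ler_norm_sum _ _ _)); apply: ler_sum => c _.
Qed.

Lemma sum4_norm_le (R : numDomainType) (T : finType) (F G : T -> T -> T -> T -> R) :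
  (forall a b c d, `|F a b c d| <= G a b c d) -> `|sum4 F| <= sum4 G.
Proof.
move=> FG; apply: (le_trans (ler_norm_sum _ _ _)); apply: ler_sum => a _.
exact: sum3_norm_le.
Qed.

Lemma card_grid (m n : nat) : #|{: 'I_m * 'I_n}| = (m * n)%N.
Proof. by rewrite card_prod !card_ord. Qed.

Lemma sum_grid_const (R : pzSemiRingType) (m n : nat) (k : R) :
  \sum_(a : 'I_m * 'I_n) k = m%:R * n%:R * k.
Proof. by rewrite sumr_const card_grid -natrM mulr_natl. Qed.

Lemma sum_same_column (R : pzSemiRingType) (m n : nat) (i : 'I_m) :
  \sum_(d : 'I_m * 'I_n) (d.1 == i)%:R = n%:R :> R.
Proof.
rewrite (sum_pointE _ _ _ (fun k _ => (k == i)%:R)) (bigD1 i) //= eqxx.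
rewrite sumr_const card_ord big1 ?addr0 // => k /negbTE ->.
by rewrite big1.
Qed.

Definition collinear_count (R : realType) (m n : nat) (a b : 'I_m * 'I_n) : R :=
  \sum_(c : 'I_m * 'I_n) (orient (grid_pt a : R * R) (grid_pt b) (grid_pt c) == 0)%:R.

(** A non-vertical line meets each column at most once. For a and b in one column the trivial bound
    mn is enough, because such pairs are rare. *)
Lemma collinear_count_le (R : realType) (m n : nat) (a b : 'I_m * 'I_n) :
  collinear_count R m n a b <= m%:R + m%:R * n%:R * (b.1 == a.1)%:R.
Proof.
rewrite /collinear_count; case: eqP => [_|/eqP ab].
  rewrite mulr1 -[leLHS]add0r lerD // -natrM -card_grid -sum1_card natr_sum.
  by apply: ler_sum => c _; case: eqP.
rewrite mulr0 addr0 (sum_pointE _ _ _ (fun i j =>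
  (orient (grid_pt a : R * R) (grid_pt b) (grid_pt (i, j)) == 0)%:R)).
rewrite -[leRHS]mulr1 -[X in _ <= X%:R * _]card_ord mulr_natl -sumr_const.
apply: ler_sum => i _.
case: (pickP (fun j : 'I_n => orient (grid_pt a : R * R) (grid_pt b) (grid_pt (i, j)) == 0)).
  move=> j /eqP oj; rewrite (bigD1 j) //= oj eqxx big1 ?addr0 // => k kj.
  case: eqP => // ok; case/eqP: kj; apply/val_inj/eqP.
  rewrite -(eqr_nat R) /=; move: oj ok; rewrite /orient /= => oj ok.
  have w0 : b.1%:R - a.1%:R != 0 :> R by rewrite subr_eq0 eqr_nat.
  by apply/eqP/(mulfI w0); lra.
by move=> oj; rewrite big1 // => j _; rewrite oj.
Qed.

Lemma sum_collinear_count_le (R : realType) (m n : nat) :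
  \sum_(a : 'I_m * 'I_n) \sum_(b : 'I_m * 'I_n) collinear_count R m n a b
  <= (m%:R * n%:R) ^+ 2 * (m%:R + n%:R).
Proof.
apply: (@le_trans _ _ (\sum_(a : 'I_m * 'I_n) (m%:R * n%:R) * (m%:R + n%:R))); last first.
  by rewrite sum_grid_const expr2 -!mulrA.
apply: ler_sum => a _.
apply: (le_trans (ler_sum _ (fun b _ => collinear_count_le R m n a b))) => /=.
rewrite big_split /= -mulr_sumr sum_same_column sum_grid_const.
by rewrite -mulrDr.
Qed.

Lemma natr_boolB_norm (R : realDomainType) (b c : bool) : `|b%:R - c%:R : R| <= 1.
Proof. by rewrite ler_norml; case: b; case: c; apply/andP; split => /=; lra. Qed.

(** It is at least 1 exactly where [winding] does not apply, and serves as the error weight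
    there. *)
Definition column_or_line {R : realType} (P Q S X : R * R) : R :=
  (X.1 == P.1)%:R + (X.1 == Q.1)%:R + (X.1 == S.1)%:R
  + (orient P Q X == 0)%:R + (orient Q S X == 0)%:R + (orient S P X == 0)%:R.

Lemma in_triangle_winding (R : realType) (P Q S X : R * R) :
  `|(in_triangle P Q S X)%:R
    + Num.sg (orient P Q S) * (col_cross P Q X + col_cross Q S X + col_cross S P X)|
  <= 4 * column_or_line P Q S X.
Proof.
have [/and5P[hP hQ hS hA /andP[hB hC]]|deg] := boolP
    [&& P.1 != X.1, Q.1 != X.1, S.1 != X.1, orient P Q X != 0, orient Q S X != 0
      & orient S P X != 0].
  rewrite winding // (_ : _ + _ = 0).
    by rewrite normr0 /column_or_line !mulr_ge0 ?addr_ge0.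
  (* The three sub-areas add up to the whole, so for an interior X their common sign is that of the
     triangle. *)
  have rel : orient P Q X + orient Q S X + orient S P X = orient P Q S.
    by rewrite /orient; ring.
  rewrite /in_triangle /in_ccw /in_cw -rel.
  move: (orient P Q X) (orient Q S X) (orient S P X) hA hB hC {rel} => A B C hA hB hC.
  rewrite !lt0_neq0 //; case: (ltrP 0 A) => hA'; case: (ltrP 0 B) => hB';
    case: (ltrP 0 C) => hC' //=; rewrite ?subr0 ?mulr0 ?addr0 ?sub0r //.
    by rewrite gtr0_sg ?addr_gt0 // mulrN1 subrr.
  rewrite ltr0_sg ?mulr1 ?subrr //.
  by move: hA hB hC; rewrite !neq_lt; lra.
have deg1 : 1 <= column_or_line P Q S X.
  move: deg; rewrite /column_or_line ![X.1 == _]eq_sym.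
  by case: (P.1 == X.1); case: (Q.1 == X.1); case: (S.1 == X.1);
    case: (orient P Q X == 0); case: (orient Q S X == 0); case: (orient S P X == 0) => //= _; lra.
apply: (@le_trans _ _ (1 + 1 * (1 + 1 + 1))); last by lra.
apply: (le_trans (ler_normD _ _)); apply: lerD; first exact: natr_bool_norm.
rewrite normrM; apply: ler_pM => //.
  by case: sgrP => _; rewrite ?normr0 ?normrN ?normr1.
apply: (le_trans (ler_normD _ _)); apply: lerD; last exact: natr_boolB_norm.
by apply: (le_trans (ler_normD _ _)); apply: lerD; exact: natr_boolB_norm.
Qed.

Lemma count_in_triangle_near (R : realType) (m n : nat) (a b c : 'I_m * 'I_n) :
  `|\sum_(d : 'I_m * 'I_n) (in_triangle (grid_pt a : R * R) (grid_pt b) (grid_pt c) (grid_pt d))%:R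
    - `|orient (grid_pt a : R * R) (grid_pt b) (grid_pt c)| / 2|
  <= 3 * (m%:R + n%:R) + 4 * (3 * n%:R + collinear_count R m n a b
       + collinear_count R m n b c + collinear_count R m n c a).
Proof.
pose P (x : 'I_m * 'I_n) : R * R := grid_pt x.
set O := orient _ _ _; set T := \sum_d _.
pose W (x y : 'I_m * 'I_n) := \sum_(d : 'I_m * 'I_n) col_cross (P x) (P y) (P d).
have h1 : `|T + Num.sg O * (W a b + W b c + W c a)| <= 4 * (3 * n%:R + collinear_count R m n a b
       + collinear_count R m n b c + collinear_count R m n c a).
  have -> : 3 * n%:R + collinear_count R m n a b
       + collinear_count R m n b c + collinear_count R m n c a
      = \sum_(d : 'I_m * 'I_n) column_or_line (P a) (P b) (P c) (P d).
    rewrite /column_or_line !big_split /= /P /=.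
    have col (x : 'I_m * 'I_n) : \sum_(d : 'I_m * 'I_n) (d.1%:R == x.1%:R :> R)%:R = n%:R :> R.
      rewrite -(sum_same_column R m n x.1); apply: eq_bigr => d _.
      by rewrite eqr_nat.
    by rewrite !col /collinear_count; ring.
  rewrite /W /T -!big_split /= mulr_sumr -big_split mulr_sumr /=.
  apply: (le_trans (ler_norm_sum _ _ _)); apply: ler_sum => d _.
  exact: in_triangle_winding.
have h2 : `|W a b + W b c + W c a + O / 2| <= 3 * (m%:R + n%:R).
  have := sum_col_cross_near R m n a b; have := sum_col_cross_near R m n b c.
  have := sum_col_cross_near R m n c a; rewrite -/(W a b) -/(W b c) -/(W c a).
  (* The shoelace formula: the signed trapezoids under the three edges sum to minus the signed
     area. *)
  have -> : O = - ((b.1%:R - a.1%:R) * (a.2%:R + b.2%:R) + (c.1%:R - b.1%:R) * (b.2%:R + c.2%:R)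
     + (a.1%:R - c.1%:R) * (c.2%:R + a.2%:R)).
    by rewrite /O /orient /grid_pt /=; ring.
  rewrite !ler_norml => /andP[? ?] /andP[? ?] /andP[? ?]; apply/andP; split; lra.
have -> : T - `|O| / 2 = (T + Num.sg O * (W a b + W b c + W c a))
    - Num.sg O * (W a b + W b c + W c a + O / 2).
  by rewrite normrEsg; ring.
apply: (le_trans (ler_normB _ _)); rewrite addrC lerD //.
apply: le_trans h2; rewrite normrM ler_piMl //.
by case: sgrP => _; rewrite ?normr0 ?normrN ?normr1.
Qed.

Lemma sum_in_triangle_near (R : realType) (m n : nat) :
  `|sum4 (fun a b c d : 'I_m * 'I_n =>
      (in_triangle (grid_pt a : R * R) (grid_pt b) (grid_pt c) (grid_pt d))%:R : R)
    - sum3 (fun a b c : 'I_m * 'I_n => `|orient (grid_pt a : R * R) (grid_pt b) (grid_pt c)|) / 2|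
  <= 27 * ((m%:R * n%:R) ^+ 3 * (m%:R + n%:R)).
Proof.
have -> : sum4 (fun a b c d : 'I_m * 'I_n =>
      (in_triangle (grid_pt a : R * R) (grid_pt b) (grid_pt c) (grid_pt d))%:R : R)
    - sum3 (fun a b c : 'I_m * 'I_n => `|orient (grid_pt a : R * R) (grid_pt b) (grid_pt c)|) / 2
  = sum3 (fun a b c : 'I_m * 'I_n => \sum_(d : 'I_m * 'I_n)
      (in_triangle (grid_pt a : R * R) (grid_pt b) (grid_pt c) (grid_pt d))%:R
      - 2^-1 * `|orient (grid_pt a : R * R) (grid_pt b) (grid_pt c)|).
  by rewrite sum3B sum3_mull [_ / 2]mulrC.
pose Z := \sum_(a : 'I_m * 'I_n) \sum_(b : 'I_m * 'I_n) collinear_count R m n a b.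
have hZ : Z <= (m%:R * n%:R) ^+ 2 * (m%:R + n%:R) := sum_collinear_count_le R m n.
pose N : R := m%:R * n%:R.
have N0 : 0 <= N by rewrite mulr_ge0.
apply: (@le_trans _ _ (N ^+ 3 * (3 * (m%:R + n%:R) + 12 * n%:R) + 4 * (N * Z + N * Z + N * Z))).
  pose G (a b c : 'I_m * 'I_n) : R := (3 * (m%:R + n%:R) + 12 * n%:R)
    + 4 * (collinear_count R m n a b + collinear_count R m n b c + collinear_count R m n c a).
  have -> : N ^+ 3 * (3 * (m%:R + n%:R) + 12 * n%:R) + 4 * (N * Z + N * Z + N * Z) = sum3 G.
    rewrite /G sum3D sum3_const sum3_mull !sum3D card_grid natrM.
    congr (_ + 4 * (_ + _ + _)); rewrite /Z /sum3.
    - rewrite mulr_sumr; apply: eq_bigr => a _; rewrite mulr_sumr; apply: eq_bigr => b _.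
      by rewrite sum_grid_const.
    - by rewrite sum_grid_const.
    - under [RHS]eq_bigr do rewrite sum_grid_const.
      by rewrite -mulr_sumr exchange_big.
  apply: sum3_norm_le => a b c; rewrite [2^-1 * _]mulrC.
  apply: (le_trans (count_in_triangle_near R m n a b c)); rewrite /G; lra.
have : N * Z <= N * (N ^+ 2 * (m%:R + n%:R)) by rewrite ler_wpM2l.
have : 0 <= N ^+ 3 * m%:R by rewrite mulr_ge0 ?exprn_ge0.
rewrite -/N (exprS N 2); lra.
Qed.

Lemma orient_grid_norm (R : realType) (m n : nat) (a b c : 'I_m * 'I_n) :
  `|orient (grid_pt a : R * R) (grid_pt b) (grid_pt c)| <= 2 * (m%:R * n%:R).
Proof.
have dist (k : nat) (x y : 'I_k) : `|x%:R - y%:R : R| <= k%:R.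
  have := ler0n R x; have := ler0n R y.
  have : x%:R <= k%:R :> R by rewrite ler_nat ltnW.
  have : y%:R <= k%:R :> R by rewrite ler_nat ltnW.
  by move=> h1 h2 h3 h4; rewrite ler_norml; apply/andP; split; lra.
apply: (le_trans (ler_normB _ _)); rewrite !normrM /= mulr_natl mulr2n.
by apply: lerD; [|rewrite mulrC]; apply: ler_pM.
Qed.

Definition sorted_area (R : realType) (m n : nat) (a b c : 'I_m * 'I_n) : R :=
  (a.1 < b.1 < c.1)%N%:R * `|orient (grid_pt a : R * R) (grid_pt b) (grid_pt c)|.

Lemma sum_sorted_area (R : realType) (m n : nat) :
  sum3 (sorted_area R m n) =
  \sum_(i < m) \sum_(k < m) \sum_(j < m) (i < j < k)%N%:R *
     (\sum_(a < n) \sum_(c < n) \sum_(b < n)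
      `|orient (i%:R, a%:R) (j%:R, b%:R) (k%:R, c%:R) : R|).
Proof.
pose v (i j k : 'I_m) (a b c : 'I_n) : R := (i < j < k)%N%:R *
  `|orient (i%:R, a%:R) (j%:R, b%:R) (k%:R, c%:R)|.
transitivity (\sum_(i < m) \sum_(k < m) \sum_(j < m)
  \sum_(a < n) \sum_(c < n) \sum_(b < n) v i j k a b c); last first.
  apply: eq_bigr => i _; apply: eq_bigr => k _; apply: eq_bigr => j _.
  rewrite mulr_sumr; apply: eq_bigr => a _.
  by rewrite mulr_sumr; apply: eq_bigr => c _; rewrite mulr_sumr.
rewrite -sum3_swap23 /sum3.
transitivity (\sum_(i < m) \sum_(a < n) \sum_(k < m) \sum_(c < n)
  \sum_(j < m) \sum_(b < n) v i j k a b c).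
  rewrite -(sum_pointE _ _ _ (fun i a => \sum_(k < m) \sum_(c < n)
    \sum_(j < m) \sum_(b < n) v i j k a b c)); apply: eq_bigr => x _.
  rewrite -(sum_pointE _ _ _ (fun k c =>
    \sum_(j < m) \sum_(b < n) v x.1 j k x.2 b c)); apply: eq_bigr => y _.
  exact: (sum_pointE _ _ _ (fun j b => v x.1 j y.1 x.2 b y.2)).
apply: eq_bigr => i _; rewrite exchange_big; apply: eq_bigr => k _ /=.
rewrite [RHS]exchange_big; apply: eq_bigr => a _ /=.
by rewrite [RHS]exchange_big; apply: eq_bigr => c _.
Qed.

Lemma sum_orders (i j k : nat) :
  ((i < j < k) + (i < k < j) + (j < i < k) + (k < i < j) + (j < k < i) + (k < j < i)
   = [&& i != j, j != k & i != k])%N.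
Proof.
by case: (ltngtP i j) => [ij|ij|->]; case: (ltngtP j k) => [jk|jk|jk] //=;
  case: (ltngtP i k) => [ik|ik|ik] //=; lia.
Qed.

(** Triples with distinct columns split into six orders, and 6 * 11/432 = 11/72. Triples with a
    repeated column number at most 3 (mn)^2 n, each with value at most 2mn. *)
Lemma sum_area_near (R : realType) (m n : nat) :
  `|sum3 (fun a b c : 'I_m * 'I_n => `|orient (grid_pt a : R * R) (grid_pt b) (grid_pt c)|)
    - 11 / 72 * (m%:R * n%:R) ^+ 4|
  <= 30 * ((m%:R * n%:R) ^+ 3 * (m%:R + n%:R)).
Proof.
pose N : R := m%:R * n%:R; have N0 : 0 <= N by rewrite mulr_ge0.
pose A (a b c : 'I_m * 'I_n) := `|orient (grid_pt a : R * R) (grid_pt b) (grid_pt c)|.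
pose s := sorted_area R m n; set D := sum3 s.
pose t (a b : 'I_m * 'I_n) : R := (b.1 == a.1)%:R.
have h1 : `|sum3 A - 6 * D| <= 2 * N * (3 * (N ^+ 2 * n%:R)).
  have -> : 6 * D = sum3 (fun a b c => s a b c + s a c b + s b a c + s c a b + s b c a + s c b a).
    have e1 : sum3 (fun a b c => s a c b) = D by exact: (sum3_swap23 _ _ s).
    have e2 : sum3 (fun a b c => s b a c) = D by exact: (sum3_swap12 _ _ s).
    have e3 : sum3 (fun a b c => s c a b) = D.
      by rewrite -e2; exact: (sum3_swap23 _ _ (fun a b c => s b a c)).
    have e4 : sum3 (fun a b c => s b c a) = D.
      by rewrite -e1; exact: (sum3_swap12 _ _ (fun a b c => s a c b)).
    have e5 : sum3 (fun a b c => s c b a) = D.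
      by rewrite -e4; exact: (sum3_swap23 _ _ (fun a b c => s b c a)).
    rewrite !sum3D e1 e2 e3 e4 e5 -/D; ring.
  rewrite -sum3B.
  have -> : 2 * N * (3 * (N ^+ 2 * n%:R)) =
     sum3 (fun a b c : 'I_m * 'I_n => 2 * N * (t a b + t b c + t a c)).
    rewrite sum3_mull !sum3D; congr (_ * _).
    have e (x : 'I_m * 'I_n) : \sum_y t x y = n%:R by exact: sum_same_column.
    rewrite /sum3.
    under [X in _ = X + _ + _]eq_bigr do under eq_bigr do rewrite sum_grid_const.
    under [X in _ = X + _ + _]eq_bigr do rewrite -mulr_sumr e.
    under [X in _ = _ + X + _]eq_bigr do under eq_bigr do rewrite e.
    under [X in _ = _ + X]eq_bigr do under eq_bigr do rewrite e.
    rewrite !sum_grid_const -/N; ring.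
  apply: sum3_norm_le => a b c.
  have ND := orient_grid_norm R m n a b c; rewrite -/(A a b c) -/N in ND.
  have A0 : 0 <= A a b c by rewrite normr_ge0.
  have s1 : s a c b = (a.1 < c.1 < b.1)%N%:R * A a b c.
    by rewrite /s /sorted_area orient_flip normrN.
  have s2 : s b a c = (b.1 < a.1 < c.1)%N%:R * A a b c.
    by rewrite /s /sorted_area orient_swap normrN.
  have s3 : s c a b = (c.1 < a.1 < b.1)%N%:R * A a b c.
    by rewrite /s /sorted_area -orient_rot.
  have s4 : s b c a = (b.1 < c.1 < a.1)%N%:R * A a b c.
    by rewrite /s /sorted_area orient_rot.
  have s5 : s c b a = (c.1 < b.1 < a.1)%N%:R * A a b c.
    by rewrite /s /sorted_area orient_rev normrN.
  have t0 (x y : 'I_m * 'I_n) : 0 <= t x y by [].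
  rewrite s1 s2 s3 s4 s5 {1}/s /sorted_area -/(A a b c) -!mulrDl -!natrD sum_orders.
  have [bac|tie] := boolP [&& a.1 != b.1 :> nat, b.1 != c.1 :> nat & a.1 != c.1 :> nat].
    by rewrite mul1r subrr normr0 mulr_ge0 ?addr_ge0 // mulr_ge0.
  rewrite mul0r subr0 (ger0_norm A0); apply: (le_trans ND).
  rewrite -[leLHS]mulr1 ler_wpM2l ?mulr_ge0 // ler1n.
  have sym (x y : 'I_m) : (x == y) = (y == x :> nat) by rewrite eq_sym.
  move: tie; rewrite !sym.
  by case: (a.1 == b.1 :> nat); case: (b.1 == c.1 :> nat); case: (a.1 == c.1 :> nat).
have h2 := sum_sorted_orient_near R m n; rewrite -sum_sorted_area -/s -/D in h2.
have h3 : 0 <= N ^+ 3 * m%:R by rewrite mulr_ge0 ?exprn_ge0.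
have h4 : 0 <= N ^+ 3 * n%:R by rewrite mulr_ge0 ?exprn_ge0.
move: h1 h2; rewrite -/A -/N.
have -> : m%:R ^+ 4 * n%:R ^+ 4 = N ^+ 4 by rewrite exprMn.
have -> : m%:R ^+ 3 * n%:R ^+ 3 = N ^+ 3 by rewrite exprMn.
have -> : 2 * N * (3 * (N ^+ 2 * n%:R)) = 6 * (N ^+ 3 * n%:R) by ring.
rewrite mulrDr; move: (N ^+ 3 * m%:R) (N ^+ 3 * n%:R) (sum3 A) h3 h4 => x y z x0 y0.
by rewrite !ler_norml => /andP[? ?] /andP[? ?]; apply/andP; split; lra.
Qed.

(** * Quadruples in convex position *)

(* Among four points in general position, either one lies in the triangle of
   the others or they form a convex quadrilateral; listing the vertices from P,
   counterclockwise, makes the six orders exclusive. *)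
Lemma ccw_or_in_triangle (R : realType) (P Q S T : R * R) :
  `|((ccw P Q S T)%:R + (ccw P Q T S)%:R + (ccw P S Q T)%:R
     + (ccw P S T Q)%:R + (ccw P T Q S)%:R + (ccw P T S Q)%:R
     + ((in_triangle P Q S T)%:R + (in_triangle P Q T S)%:R
        + (in_triangle P S T Q)%:R + (in_triangle Q S T P)%:R)) - 1 : R|
  <= 10 * ((orient Q S T == 0)%:R + (orient P S T == 0)%:R
           + (orient P Q T == 0)%:R + (orient P Q S == 0)%:R).
Proof.
have b01 (b : bool) : 0 <= (b%:R : R) <= 1 by case: b; rewrite ?lexx ?ler01.
have [/and4P[hA hB hC hD]|deg] := boolP
  [&& orient Q S T != 0, orient P S T != 0, orient P Q T != 0 & orient P Q S != 0].
  have ePSQ := orient_flip R P Q S; have eQTS := orient_flip R Q S T.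
  have ePTS := orient_flip R P S T; have ePTQ := orient_flip R P Q T.
  have eSQT := orient_swap R Q S T; have eSTQ := orient_rot R Q S T.
  have eTQS := esym (orient_rot R T Q S).
  have eTSQ := orient_rev R Q S T; have eSPT := orient_swap R P S T.
  have eTPS := esym (orient_rot R T P S).
  have eTPQ := esym (orient_rot R T P Q).
  have eQSP := orient_rot R P Q S; have eSTP := orient_rot R P S T.
  have eTQP := orient_rev R P Q T.
  have rel : orient P Q S + orient P S T = orient P Q T + orient Q S T.
    by rewrite /orient; ring.
  rewrite /ccw /in_triangle /in_ccw /in_cw.
  rewrite eTQS eTPS eTPQ eQSP eSTP eTQP eSPT eTSQ eSTQ eSQT ePTQ ePTS eQTS ePSQ.
  rewrite !oppr_gt0 !oppr_lt0 => {eTQS eTPS eTPQ eQSP eSTP eTQP eSPT eTSQ eSTQ eSQT ePTQ ePTS eQTS ePSQ}.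
  move: (orient P Q S) (orient P S T) (orient P Q T) (orient Q S T) hA hB hC hD rel.
  move=> D B C A hA hB hC hD rel; rewrite !lt0_neq0 //.
  have n1 : ~~ [&& 0 < A, 0 < C, ~~ (0 < B) & ~~ (0 < D)].
    by rewrite -!lt0_neq0 //; apply/negP => /and4P[]; lra.
  have n2 : ~~ [&& ~~ (0 < A), ~~ (0 < C), 0 < B & 0 < D].
    by rewrite -!lt0_neq0 //; apply/negP => /and4P[]; lra.
  rewrite [X in `|X|](_ : _ = 0) ?normr0 ?mulr_ge0 ?addr_ge0 //.
  move: n1 n2; case: (0 < A); case: (0 < B); case: (0 < C); case: (0 < D) => //= _ _; ring.
apply: (@le_trans _ _ 10); last first.
  rewrite -[leLHS]mulr1 ler_wpM2l //; move: deg.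
  by case: (orient Q S T == 0); case: (orient P S T == 0); case: (orient P Q T == 0);
    case: (orient P Q S == 0) => //= _; lra.
have /andP[? ?] := b01 (ccw P Q S T); have /andP[? ?] := b01 (ccw P Q T S).
have /andP[? ?] := b01 (ccw P S Q T); have /andP[? ?] := b01 (ccw P S T Q).
have /andP[? ?] := b01 (ccw P T Q S); have /andP[? ?] := b01 (ccw P T S Q).
have /andP[? ?] := b01 (in_triangle P Q S T); have /andP[? ?] := b01 (in_triangle P Q T S).
have /andP[? ?] := b01 (in_triangle P S T Q); have /andP[? ?] := b01 (in_triangle Q S T P).
rewrite ler_norml; apply/andP; split; lra.
Qed.

(** Summed over all quadruples, [ccw_or_in_triangle] says that 6 times the convex sum plus 4 times
    the triangle sum is nearly (mn)^4. The error is at most (40 + 4 (27 + 15)) / 6 < 35. *)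
Lemma sum_ccw_near (R : realType) (m n : nat) :
  `|sum4 (fun a b c d : 'I_m * 'I_n =>
      (ccw (grid_pt a : R * R) (grid_pt b) (grid_pt c) (grid_pt d))%:R : R)
    - 25 / 216 * (m%:R * n%:R) ^+ 4|
  <= 35 * ((m%:R * n%:R) ^+ 3 * (m%:R + n%:R)).
Proof.
pose N : R := m%:R * n%:R; have N0 : 0 <= N by rewrite mulr_ge0.
pose q (a b c d : 'I_m * 'I_n) : R :=
  (ccw (grid_pt a : R * R) (grid_pt b) (grid_pt c) (grid_pt d))%:R.
pose t (a b c d : 'I_m * 'I_n) : R :=
  (in_triangle (grid_pt a : R * R) (grid_pt b) (grid_pt c) (grid_pt d))%:R.
pose z (a b c : 'I_m * 'I_n) : R :=
  (orient (grid_pt a : R * R) (grid_pt b) (grid_pt c) == 0)%:R.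
pose Z := \sum_(a : 'I_m * 'I_n) \sum_(b : 'I_m * 'I_n) collinear_count R m n a b.
have hZ : Z <= N ^+ 2 * (m%:R + n%:R) := sum_collinear_count_le R m n.
pose G := ('I_m * 'I_n)%type.
have swap34 (F : G -> G -> G -> G -> R) : sum4 (fun a b c d => F a b d c) = sum4 F.
  exact: sum4_swap34.
have swap23 (F : G -> G -> G -> G -> R) : sum4 (fun a b c d => F a c b d) = sum4 F.
  exact: sum4_swap23.
have swap12 (F : G -> G -> G -> G -> R) : sum4 (fun a b c d => F b a c d) = sum4 F.
  exact: sum4_swap12.
have p1 (F : G -> G -> G -> G -> R) : sum4 (fun a b c d => F a c d b) = sum4 F.
  by rewrite -[RHS]swap34; exact: (swap23 (fun a b c d => F a b d c)).
have p2 (F : G -> G -> G -> G -> R) : sum4 (fun a b c d => F a d b c) = sum4 F.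
  by rewrite -[RHS]swap23; exact: (swap34 (fun a b c d => F a c b d)).
have p3 (F : G -> G -> G -> G -> R) : sum4 (fun a b c d => F a d c b) = sum4 F.
  by rewrite -[RHS]p1; exact: (swap34 (fun a b c d => F a c d b)).
have p4 (F : G -> G -> G -> G -> R) : sum4 (fun a b c d => F b c d a) = sum4 F.
  by rewrite -[RHS]p1; exact: (swap12 (fun a b c d => F a c d b)).
have h1 : `|6 * sum4 q + 4 * sum4 t - N ^+ 4| <= 40 * (N * Z).
  have -> : 6 * sum4 q + 4 * sum4 t - N ^+ 4 = sum4 (fun a b c d : 'I_m * 'I_n =>
    q a b c d + q a b d c + q a c b d + q a c d b + q a d b c + q a d c b
    + (t a b c d + t a b d c + t a c d b + t b c d a) - 1).
    rewrite sum4B !sum4D sum4_const card_grid natrM -/N mulr1.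
    rewrite (swap34 q) (swap23 q) (p1 q) (p2 q) (p3 q) (swap34 t) (p1 t) (p4 t).
    by ring.
  have -> : 40 * (N * Z) = sum4 (fun a b c d : 'I_m * 'I_n =>
     10 * (z b c d + z a c d + z a b d + z a b c)).
    rewrite sum4_mull !sum4D; rewrite /sum4 /sum3.
    under [X in _ * (_ + X + _ + _)]eq_bigr do rewrite sum_grid_const.
    under [X in _ * (_ + _ + X + _)]eq_bigr do
      under eq_bigr do rewrite sum_grid_const.
    under [X in _ * (_ + _ + _ + X)]eq_bigr do
      under eq_bigr do under eq_bigr do rewrite sum_grid_const.
    under [X in _ * (_ + _ + _ + X)]eq_bigr do
      under eq_bigr do rewrite -mulr_sumr.
    under [X in _ * (_ + _ + X + _)]eq_bigr do rewrite -mulr_sumr.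
    under [X in _ * (_ + _ + _ + X)]eq_bigr do rewrite -mulr_sumr.
    rewrite -!mulr_sumr sum_grid_const -/N.
    rewrite -/Z; ring.
  by apply: sum4_norm_le => a b c d; exact: ccw_or_in_triangle.
have h2 := sum_in_triangle_near R m n; have h3 := sum_area_near R m n.
have h4 : N * Z <= N ^+ 3 * (m%:R + n%:R).
  by rewrite (exprS N 2) -mulrA ler_wpM2l.
rewrite -/N -/q -/t in h1 h2 h3 h4 *.
have h5 : 0 <= N ^+ 3 * (m%:R + n%:R) by rewrite mulr_ge0 ?exprn_ge0 ?addr_ge0.
move: h2 h3; set O := sum3 _; move: h1 h4 h5.
move: (N ^+ 3 * _) (N ^+ 4) (N * Z) (sum4 q) (sum4 t) O => x y u v w o.
rewrite !ler_norml => /andP[? ?] ? ? /andP[? ?] /andP[? ?]; apply/andP; split; lra.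
Qed.

(** * Asymptotics of p *)

(** One indicator is replaced at a time: u u' - c^2 = u' (u - c) + c (u' - c). Each part is a
    [sieve] in one point with the other three fixed; for the second, [ccw_rot2] moves that point
    into the second place. *)
Lemma sum_prime_ccw_near (R : realType) (m n K : nat) (c : R) :
  (0 < K)%N -> 0 <= c <= 1 ->
  `|(p R m n)%:R * 2 - c ^+ 2 * sum4 (fun x y z t : 'I_m * 'I_n =>
      (ccw (grid_pt x : R * R) (grid_pt y) (grid_pt z) (grid_pt t))%:R : R)|
  <= 2 * ((m%:R * n%:R) ^+ 3 * ((1 + 2 * K%:R) * (m%:R + n%:R)
     + m%:R * n%:R * ((K%:R)^-1 + `|mobius_sum R K - c|))).
Proof.
move=> K0 /andP[c0 c1]; set B := _ + _ * (_ + _).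
pose G := ('I_m * 'I_n)%type.
pose q (x y z t : G) : R := (ccw (grid_pt x : R * R) (grid_pt y) (grid_pt z) (grid_pt t))%:R.
pose u (x y : G) : R := (point_gcd x.1 x.2 m n y == 1%N)%:R.
have u1 x y : `|u x y| <= 1 by exact: natr_bool_norm.
have h (x z t : G) : `|\sum_(y : G) q x y z t * (u x y - c)| <= B.
  exact: (sieve R m n K x (fun i j => ccw (grid_pt x : R * R) (i%:R, j%:R) (grid_pt z) (grid_pt t)) c K0
    (ccw_biconvex R _ _ _)).
have bound (F : G -> G -> G -> R) : (forall x y z, `|F x y z| <= B) ->
    `|sum3 F| <= (m%:R * n%:R) ^+ 3 * B.
  move=> FB; rewrite -natrM -card_grid -sum3_const; exact: sum3_norm_le.
have -> : (p R m n)%:R * 2 - c ^+ 2 * sum4 q =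
    sum3 (fun x z t => u z t * \sum_(y : G) q x y z t * (u x y - c))
  + sum3 (fun x y z => c * \sum_(t : G) q x y z t * (u z t - c)).
  rewrite natr_pE -sum4_mull.
  have -> : sum3 (fun x z t => u z t * \sum_(y : G) q x y z t * (u x y - c)) =
      sum4 (fun x y z t => u z t * (q x y z t * (u x y - c))).
    rewrite -sum4_swap23 -sum4_swap34; apply: eq_bigr => x _; apply: eq_bigr => z _.
    by apply: eq_bigr => t _; rewrite mulr_sumr.
  have -> : sum3 (fun x y z => c * \sum_(t : G) q x y z t * (u z t - c)) =
      sum4 (fun x y z t => c * (q x y z t * (u z t - c))).
    apply: eq_bigr => x _; apply: eq_bigr => y _; apply: eq_bigr => z _.
    by rewrite mulr_sumr.
  rewrite -sum4D -sum4B; apply: eq_bigr => x _; apply: eq_bigr => y _.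
  by apply: eq_bigr => z _; apply: eq_bigr => t _; rewrite /u /q; ring.
apply: (le_trans (ler_normD _ _)); rewrite mulr_natl mulr2n; apply: lerD; apply: bound.
  by move=> x z t; rewrite normrM; apply: le_trans (h x z t); rewrite ler_piMl.
move=> x y z; rewrite normrM (ger0_norm c0).
have -> : \sum_(t : G) q x y z t * (u z t - c) = \sum_(t : G) q z t x y * (u z t - c).
  by apply: eq_bigr => t _; rewrite /q ccw_rot2.
by apply: le_trans (h z x y); rewrite ler_piMl.
Qed.

(** With K = L^2 the sieve loses 1/K <= 1/L and the density 4/L, hence 5/L. After halving, the
    geometric errors are 1 + 2K and 35/2, below 19 + 2K. *)
Lemma p_near (R : realType) (m n L : nat) : (0 < L)%N ->
  `|(p R m n)%:R - 25 / (12 * pi ^+ 4) * (m%:R * n%:R) ^+ 4 : R|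
  <= 5 / L%:R * (m%:R * n%:R) ^+ 4
     + (19 + 2 * (L ^ 2)%N%:R) * ((m%:R * n%:R) ^+ 3 * (m%:R + n%:R)).
Proof.
move=> L0; set K := (L ^ 2)%N; have K0 : (0 < K)%N by rewrite expn_gt0 L0.
pose c : R := 6 / pi ^+ 2.
have pi0 := pi_gt0 R.
have c01 : 0 <= c <= 1.
  have := zeta2_sum_le R 1; rewrite /zeta2_sum big_nat1 expr1n invr1 => z1.
  have p2 : 0 < pi ^+ 2 :> R by rewrite exprn_gt0.
  by rewrite /c divr_ge0 ?(ltW p2) //= ler_pdivrMr // mul1r; lra.
have h1 := sum_prime_ccw_near R m n K c K0 c01.
have h2 := sum_ccw_near R m n.
have h3 := mobius_sum_near R L L0; rewrite -/K -/c in h3.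
have e : 25 / (12 * pi ^+ 4) = c ^+ 2 * (25 / 432) :> R.
  by rewrite /c; move: (@pi R) pi0 => x x0; field; rewrite lt0r_neq0.
have h4 : (K%:R)^-1 <= (L%:R)^-1 :> R.
  by rewrite lef_pV2 ?posrE ?ltr0n // ler_nat /K -[X in (X <= _)%N]expn1 leq_pexp2l.
have h5 : 5 / L%:R = L%:R^-1 + 4 / L%:R :> R by field; rewrite pnatr_eq0 -lt0n.
have c2 : 0 <= c ^+ 2 <= 1.
  by case/andP: c01 => x0 x1; rewrite sqr_ge0 /= expr_le1.
pose N : R := m%:R * n%:R; have N0 : 0 <= N by rewrite mulr_ge0.
pose E : R := N ^+ 3 * (m%:R + n%:R).
have E0 : 0 <= E by rewrite mulr_ge0 ?exprn_ge0 ?addr_ge0.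
have hB : N ^+ 4 * ((K%:R)^-1 + `|mobius_sum R K - c|) <= N ^+ 4 * (5 / L%:R).
  by rewrite ler_wpM2l ?exprn_ge0 //; lra.
move: h1 h2; rewrite -/N -/E e.
have -> : 2 * (N ^+ 3 * ((1 + 2 * K%:R) * (m%:R + n%:R)
    + N * ((K%:R)^-1 + `|mobius_sum R K - c|))) =
  2 * ((1 + 2 * K%:R) * E + N ^+ 4 * ((K%:R)^-1 + `|mobius_sum R K - c|)).
  by rewrite /E; ring.
set S := sum4 _ => h1 h2.
have -> : (p R m n)%:R - c ^+ 2 * (25 / 432) * N ^+ 4 =
  ((p R m n)%:R * 2 - c ^+ 2 * S) / 2 + c ^+ 2 * (S - 25 / 216 * N ^+ 4) / 2 by field.
have h6 : `|c ^+ 2 * (S - 25 / 216 * N ^+ 4)| <= 35 * E.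
  case/andP: c2 => x0 x1; rewrite normrM (ger0_norm x0).
  by apply: le_trans h2; rewrite ler_piMl.
have half (y : R) : `|y / 2| = `|y| / 2 by rewrite normrM [`|2^-1|]ger0_norm.
apply: (le_trans (ler_normD _ _)); rewrite !half.
move: h1 h6 hB; move: (`|_ * 2 - _|) (`|_ * (_ - _)|) (N ^+ 4 * (_ + _)) => x y z.
lra.
Qed.

Theorem theorem26 (R : realType) :
  (fun mn : nat * nat => (p R mn.1 mn.2)%:R : R^o) =
  (fun mn : nat * nat =>
     25 / (12 * pi ^+ 4) * (mn.1%:R ^+ 4 * mn.2%:R ^+ 4) : R^o)
  +o_ (filter_prod \oo \oo)
  (fun mn : nat * nat => mn.1%:R ^+ 4 * mn.2%:R ^+ 4 : R^o).
Proof.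
apply/eqaddoP => eps eps0.
(* L makes 5/L at most eps/2. It fixes C, and only then is M chosen so that C (m+n) is at most
   (eps/2) mn once both sides reach M. *)
pose L := (Num.bound (10 / eps)).+1.
pose C : R := 19 + 2 * (L ^ 2)%N%:R.
have C0 : 0 < C by rewrite ltr_wpDr ?mulr_ge0.
pose M := (Num.bound (4 * C / eps)).+1.
exists ([set m | (M <= m)%N], [set n | (M <= n)%N]) => /=.
  by split; exact: nbhs_infty_ge.
move=> [m n] [/= Mm Mn].
have l0 : 0 < L%:R :> R by rewrite ltr0n.
have L1 : 5 / L%:R <= eps / 2.
  have : 10 / eps < L%:R.
    rewrite (lt_le_trans (archi_boundP _)) ?divr_ge0 ?(ltW eps0) //.
    by rewrite ler_nat.
  rewrite ltr_pdivrMr // => h; rewrite ler_pdivrMr //; lra.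
have M1 : 4 * C <= eps * M%:R.
  have : 4 * C / eps < M%:R.
    rewrite (lt_le_trans (archi_boundP _)) ?divr_ge0 ?mulr_ge0 ?(ltW eps0) ?(ltW C0) //.
    by rewrite ler_nat.
  rewrite ltr_pdivrMr // [M%:R * _]mulrC; exact: ltW.
have N4 : m%:R ^+ 4 * n%:R ^+ 4 = (m%:R * n%:R) ^+ 4 :> R by rewrite exprMn.
rewrite !fctE /= N4 [X in eps * X]ger0_norm ?exprn_ge0 ?mulr_ge0 //.
apply: (le_trans (p_near R m n L _)) => //; rewrite -/C.
set N : R := m%:R * n%:R; have N0 : 0 <= N by rewrite mulr_ge0.
(* Both sides must reach M: each of m and n is bounded by mn/M through the other. *)
have mn : M%:R * (m%:R + n%:R) <= 2 * N.
  have : M%:R * m%:R <= n%:R * m%:R :> R by rewrite ler_wpM2r // ler_nat.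
  have : M%:R * n%:R <= m%:R * n%:R :> R by rewrite ler_wpM2r // ler_nat.
  rewrite /N; lra.
have h : C * (m%:R + n%:R) <= eps / 2 * N.
  have s0 : 0 <= m%:R + n%:R :> R by rewrite addr_ge0.
  have := ler_wpM2r s0 M1; have := ler_wpM2l (ltW eps0) mn; lra.
have N3 : 0 <= N ^+ 3 by rewrite exprn_ge0.
have := ler_wpM2l N3 h; have := ler_wpM2r (exprn_ge0 4 N0) L1.
rewrite mulrCA [N ^+ 3 * (eps / 2 * N)]mulrCA -exprSr; lra.
Qed.
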